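(* Let $X$ be a synchronizing shift space and let $p\in X$ be a synchronizing periodic point. Then, as topological (étale) groupoids, (i) $\displaystyle G^{\mathrm{lcs}}(X,\sigma,p)\cong\bigcup_{N\ge0}G\big(B^{\mathrm{lcs}}_N(X,p)\big)$, and (ii) $\displaystyle G^{\mathrm{lcu}}(X,\sigma,p)\cong\bigcup_{N\ge0}G\big(B^{\mathrm{lcu}}_N(X,p)\big)$.
   Context: **Shift spaces.** A shift space is a closed, shift-invariant subset $X\subseteq\mathcal A^{\mathbb Z}$ ($\mathcal A$ a finite alphabet), with shift map $\sigma(x)_i=x_{i+1}$. $\mathcal L(X)$ is the set of finite words (including the empty word) occurring in elements of $X$; $x_{[i,j]}=x_i\cdots x_j$. $X$ is irreducible if for all $w,v\in\mathcal L(X)$ there is $u\in\mathcal L(X)$ with $wuv\in\mathcal L(X)$. A word $w\in\mathcal L(X)$ is synchronizing if $uw,wv\in\mathcal L(X)$ implies $uwv\in\mathcal L(X)$; a point is synchronizing if it contains a synchronizing word; $X$ is synchronizing if it is irreducible and has a synchronizing point. The metric is $d(x,y)=\inf_{n\ge1}\{2^{-n}: x_i=y_i \text{ for all } |i|<n\}$ if $x_0=y_0$, and $d(x,y)=1$ otherwise. For $w\in\mathcal L(X)$, $E^+(w)=\{b\in\mathcal L(X):wb\in\mathcal L(X)\}$ and $E^-(w)=\{a\in\mathcal L(X):aw\in\mathcal L(X)\}$. **The groupoids.** For $x\in X$, $N\ge0$ put $X^{u}(x,N)=\{y\in X: y_n=x_n\ \forall n\le N\}$ and $X^{s}(x,N)=\{y\in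 X:y_n=x_n\ \forall n\ge -N\}$. $x\sim_{\mathrm{lcs}}y$ means: there are $N,N'\ge0$ and a homeomorphism $\gamma$ from $X^{u}(x,N)$ onto an open subset of $X^{u}(y,N')$ with $\gamma(x)=y$ and $\lim_{n\to\infty}\sup_{z\in X^{u}(x,N)}d(\sigma^n(z),\sigma^n(\gamma(z)))=0$ (a stable local conjugacy). $x\sim_{\mathrm{lcu}}y$ means: there are $N,N'\ge 0$ and a homeomorphism $\gamma$ from $X^{s}(x,N)$ onto an open subset of $X^{s}(y,N')$ with $\gamma(x)=y$ and $\lim_{n\to\infty}\sup_{z\in X^{s}(x,N)}d(\sigma^{-n}(z),\sigma^{-n}(\gamma(z)))=0$ (an unstable local conjugacy). Let $X^{u}(p)=\{x\in X:\exists M\in\mathbb Z,\ x_n=p_n\ \forall n\le M\}$, with topology having basis the sets $\{z\in X: z_n=x_n\ \forall n\le M\}$ ($x\in X^{u}(p)$, $M\in\mathbb Z$), and $X^{s}(p)=\{x\in X:\exists M\in\mathbb Z,\ x_n=p_n\ \forall n\ge M\}$, with basis $\{z\in X:z_n=x_n\ \forall n\ge M\}$. $G^{\mathrm{lcs}}(X,\sigma,p)=\{(x,y)\in X^{u}(p)\times X^{u}(p): x\sim_{\mathrm{lcs}}y\}$ has topology with basis the graphs $\{(z,\gamma(z)):z\in X^{u}(x,N)\}$ of stable local conjugacies $\gamma$ on $X^u(x,N)$ with $x,\gamma(x)\in X^{u}(p)$; $G^{\mathrm{lcu}}(X,\sigma,p)=\{(x,y)\in X^{s}(p)\times X^{s}(p):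 x\sim_{\mathrm{lcu}}y\}$ is topologized likewise by graphs of unstable local conjugacies. **Groupoid of a Bratteli diagram.** A Bratteli diagram $B$ consists of finite vertex sets $V_n$ and finite edge sets $E_n$, $n\ge n_0$, with each $e\in E_n$ having initial vertex $i(e)\in V_n$ and terminal vertex $t(e)\in V_{n+1}$. $B^\infty=\{(e_{n_0},e_{n_0+1},\dots): e_n\in E_n,\ t(e_n)=i(e_{n+1})\}$ with topology from $\prod E_n$. $G(B)=\{(e,e')\in B^\infty\times B^\infty:\exists M,\ e_n=e_n'\ \forall n>M\}$, with topology having basis the sets $\{(f,(e'_{n_0},\dots,e'_M,f_{M+1},\dots)): f\in B^\infty,\ f_n=e_n\ \forall n\le M\}$ for $(e,e')\in G(B)$ with $e_n=e'_n$ for all $n>M$. **The diagrams.** For $N\ge0$ choose $k\ge N$ with $p_{[-k,-N]}$ synchronizing and put $E^+(p_{(-\infty,-N]}w):=E^+(p_{[-k,-N]}w)$ (independent of the choice of $k$). $B^{\mathrm{lcs}}_N(X,p)$ has levels $n\ge -N$: $V_{-N}=\{*\}$ (the class of the empty word); for $n>-N$, $V_n$ is the set of words $w\in E^+(p_{(-\infty,-N]})$ of length $n+N$ modulo $w\sim v\iff E^+(p_{(-\infty,-N]}w)=E^+(p_{(-\infty,-N]}v)$; and for each $[w]\in V_n$ and each letter $a\in E^+(p_{(-\infty,-N]}w)$ there is one edge, labelled $a$, from $[w]$ to $[wa]\in V_{n+1}$. The inclusion $B^{\mathrm{lcs}}_N(X,p)^\infty\subseteq B^{\mathrm{lcs}}_{N+1}(X,p)^\infty$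 sends the path with label sequence $(a_1,a_2,\dots)$ to the path with label sequence $(p_{-N},a_1,a_2,\dots)$, and induces $G(B^{\mathrm{lcs}}_N(X,p))\subseteq G(B^{\mathrm{lcs}}_{N+1}(X,p))$ as an open subgroupoid. The unions carry the inductive limit topology. $B^{\mathrm{lcu}}_N(X,p)$ is the mirror image: with $k\ge N$ such that $p_{[N,k]}$ is synchronizing and $E^-(wp_{[N,\infty)}):=E^-(wp_{[N,k]})$, level $n>-N$ consists of words $w\in E^-(p_{[N,\infty)})$ of length $n+N$ modulo $E^-(wp_{[N,\infty)})=E^-(vp_{[N,\infty)})$, with one edge labelled $a$ from $[w]$ to $[aw]$ for each letter $a\in E^-(wp_{[N,\infty)})$; the inclusion into $B^{\mathrm{lcu}}_{N+1}(X,p)$ prefixes the label $p_N$. *)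

(* Defs.v *)
From Stdlib Require Import Relation_Operators.
From HB Require Import structures.
From mathcomp Require Import all_boot all_order all_algebra.
From mathcomp Require Import generic_quotient.
From mathcomp Require Import all_classical all_reals all_analysis.
From mathcomp Require Import zify.

Set Implicit Arguments.
Unset Strict Implicit.
Unset Printing Implicit Defensive.

Import Order.TTheory GRing.Theory Num.Theory.
Import numFieldNormedType.Exports.

Local Open Scope classical_set_scope.
Local Open Scope ring_scope.

(** * Shift spaces *)

(* The full shift: bi-infinite sequences with the product of the discrete
   topologies. *)
Definition fullshift (A : finType) : topologicalType :=
  {ptws int -> discrete_topology A}.

Section Shifts.
Context {A : finType}.
Implicit Types (X : set (fullshift A)) (x y p : fullshift A) (w u v : seq A).

Definition shift_map x : fullshift A := fun i => x (i + 1).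
Definition unshift_map x : fullshift A := fun i => x (i - 1).

Definition shift_space X := closed X /\ shift_map @` X = X.

(* [factor x i n] is the word of length [n] starting at position [i], i.e.
   x_[i, i + n - 1]. *)
Definition factor x (i : int) (n : nat) : seq A :=
  [seq x (i + k%:Z) | k <- iota 0 n].

Definition occurs w x := exists i, w = factor x i (size w).

Definition language X : set (seq A) :=
  [set w | exists2 x, X x & occurs w x].

Definition irreducible X := forall w v, language X w -> language X v ->
  exists2 u, language X u & language X (w ++ u ++ v).

Definition synchronizing_word X w := language X w /\
  forall u v, language X (u ++ w) -> language X (w ++ v) ->
    language X (u ++ w ++ v).

Definition synchronizing_point X x :=
  exists2 w, synchronizing_word X w & occurs w x.

Definition synchronizing X := irreducible X /\
  exists2 x, X x & synchronizing_point X x.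

Definition periodic_point x := exists2 n : nat, (0 < n)%N & iter n shift_map x = x.

Definition Eplus X w : set (seq A) :=
  [set b | language X b /\ language X (w ++ b)].
Definition Eminus X w : set (seq A) :=
  [set a | language X a /\ language X (a ++ w)].

Definition shift_dist (R : realType) x y : R :=
  if x 0 == y 0 then
    inf [set 2^-1 ^+ n | n in
      [set n : nat | (1 <= n)%N /\ forall i : int, `|i| < n%:Z -> x i = y i]]
  else 1.

Lemma shift_dist_set_lb (R : realType) x y : lbound [set 2^-1 ^+ n | n in
  [set n : nat | (1 <= n)%N /\ forall i : int, `|i| < n%:Z -> x i = y i]] (0 : R).
Proof. by move=> _ [n _ <-]; rewrite exprn_ge0. Qed.

Lemma shift_dist_set_1 (R : realType) x y : x 0 = y 0 -> [set 2^-1 ^+ n | n in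
  [set n : nat | (1 <= n)%N /\ forall i : int, `|i| < n%:Z -> x i = y i]]
  (2^-1 : R).
Proof.
move=> e; exists 1%N; last by rewrite expr1.
split=> // i i1; suff -> : i = 0 by [].
lia.
Qed.

Lemma shift_dist_ge0 (R : realType) x y : 0 <= shift_dist R x y.
Proof.
rewrite /shift_dist; case: eqP => // e; apply: lb_le_inf.
  by exists 2^-1; exact: shift_dist_set_1.
exact: shift_dist_set_lb.
Qed.

Lemma shift_dist_le1 (R : realType) x y : shift_dist R x y <= 1.
Proof.
rewrite /shift_dist; case: eqP => // e; apply: (@le_trans _ _ 2^-1).
  apply: ge_inf; last exact: shift_dist_set_1.
  by exists 0; exact: shift_dist_set_lb.
by rewrite invf_le1 ?ler1n.
Qed.

Lemma nbhs_coord (w : fullshift A) (i : int) : nbhs w [set u | u i = w i].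
Proof.
have pc := @proj_continuous int (fun _ => discrete_topology A) i w.
by apply: (pc [set a | a = w i]); rewrite nbhs_principalE; apply/principal_filterP.
Qed.

Lemma nbhs_cylinder (w : fullshift A) (M : nat) :
  nbhs w [set u | forall i : int, `|i| < M%:Z -> u i = w i].
Proof.
elim: M => [|M IH]; first by apply: filterE => u i; lia.
apply: filterS (filterI IH (filterI (nbhs_coord w M%:Z)
  (nbhs_coord w (- M%:Z)))) => u [{}IH [/= e1 e2]] i iM.
have [iM'|] := ltrP `|i| M%:Z; first exact: IH.
move=> Mi; have [->|->] : i = M%:Z \/ i = - M%:Z by lia.
all: by [].
Qed.

Lemma open_cylinder (z : fullshift A) (M : nat) :
  open [set u : fullshift A | forall i : int, `|i| < M%:Z -> u i = z i].
Proof.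
rewrite openE => w /= wz; apply: filterS (nbhs_cylinder w M) => u uw i iM.
by rewrite uw // wz.
Qed.

Lemma cylinder_base (z : fullshift A) U : nbhs z U ->
  exists M : nat, forall y : fullshift A,
    (forall i : int, `|i| < M%:Z -> y i = z i) -> U y.
Proof.
pose F : set_system (fullshift A) := filter_from [set: nat]
  (fun M => [set u | forall i : int, `|i| < M%:Z -> u i = z i]).
have FF : Filter F.
  apply: filter_from_filter; first by exists 0%N.
  move=> M1 M2 _ _; exists (maxn M1 M2) => // u Hu.
  by split=> i iM; apply: Hu; lia.
suff : F --> z by move=> /(_ U)/[apply] -[M _ HM]; exists M.
apply/(@cvg_sup _ _ _ F z FF) => i V.
rewrite (@nbhsE (initial_topology (fun f : fullshift A => f i))).
move=> -[W [[Q oQ <-] Qz] WV].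
exists `|i|%N.+1 => // u Hu; apply: WV => /=.
suff -> : u i = z i by [].
by apply: Hu; lia.
Qed.

End Shifts.

(** * Groupoids with a topology *)

(* A groupoid is presented by its space of arrows and the graph of its partial
   product: [gprod g h k] means that (g, h) is composable and g h = k.  The
   units and the inverse are determined by the product. *)
Record topGroupoid := TopGroupoid {
  arrows :> topologicalType;
  gprod : arrows -> arrows -> arrows -> Prop
}.

Definition topGroupoid_iso (G H : topGroupoid) :=
  exists (f : G -> H) (g : H -> G),
    [/\ cancel f g, cancel g f, continuous f, continuous g
      & forall a b c, gprod a b c <-> gprod (f a) (f b) (f c)].

(* The product of the groupoid of an equivalence relation. *)
Definition pair_prod (T : Type) (g h k : T * T) := g.2 = h.1 /\ k = (g.1, h.2).

(** * The groupoids of stable and unstable local conjugacies *)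

Section LocalConjugacy.
Context (R : realType) {A : finType}.
Notation T := (fullshift A).

(* [gamma] restricts to a homeomorphism from [D] onto a relatively open subset
   of [D']; its values outside [D] are irrelevant. *)
Definition homeo_onto_open (D D' : set T) (gamma : T -> T) :=
  exists (delta : T -> T) (V : set T),
    [/\ open V, gamma @` D = D' `&` V, (forall z, D z -> delta (gamma z) = z),
        {within D, continuous gamma} & {within gamma @` D, continuous delta}].

(* [S x N] is the local set X^u(x, N) or X^s(x, N), and [phi] is the shift,
   respectively its inverse; [P] is X^u(p) or X^s(p). *)
Variables (S : T -> nat -> set T) (phi : T -> T) (P : set T).

Definition local_conjugacy (x : T) (N : nat) (y : T) (N' : nat)
    (gamma : T -> T) :=
  [/\ homeo_onto_open (S x N) (S y N') gamma, gamma x = y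
    & (fun n => sup [set shift_dist R (iter n phi z) (iter n phi (gamma z))
                    | z in S x N]) @ \oo --> (0 : R)].

Definition locally_conjugate (x y : T) :=
  exists N N' gamma, local_conjugacy x N y N' gamma.

Definition lc_arrow : Type := {g : T * T |
  `[< [/\ P g.1, P g.2 & locally_conjugate g.1 g.2] >]}.

HB.instance Definition _ := Choice.copy lc_arrow
  {g : T * T | `[< [/\ P g.1, P g.2 & locally_conjugate g.1 g.2] >]}.

Definition lc_prod (g h k : lc_arrow) := pair_prod (val g) (val h) (val k).

Definition lc_basis : set (set lc_arrow) :=
  [set U | exists x N N' gamma,
    [/\ P x, P (gamma x), local_conjugacy x N (gamma x) N' gamma
      & U = [set g | S x N (val g).1 /\ (val g).2 = gamma (val g).1]]].

Lemma dist_ubound (D : set T) (f g : T -> T) :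
  has_ubound [set shift_dist R (f z) (g z) | z in D].
Proof. by exists 1 => _ [z _ <-]; exact: shift_dist_le1. Qed.

(* The graphs of local conjugacies form a base: these are the properties of the
   local sets used in the proof. *)
Hypothesis S_eq : forall x N z, S x N z -> S z N = S x N.
Hypothesis S_refl : forall x N, P x -> S x N x.
Hypothesis S_open : forall x N z K, S x N z -> (N <= K)%N ->
  exists2 Q, open Q & S z K = S x N `&` Q.
Hypothesis S_nbhs : forall z U, nbhs z U ->
  exists K0, forall K, (K0 <= K)%N -> S z K `<=` U.
Hypothesis S_sep : forall w N1 N2 u v, S w N1 u -> S w N2 v ->
  (forall n, iter n phi u 0 = iter n phi v 0) -> u = v.
Hypothesis phi_nbhs : forall w n,
  nbhs w [set u | iter n phi u 0 = iter n phi w 0].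

Lemma local_conjugacyW x N y N' gamma z K :
  local_conjugacy x N y N' gamma -> S x N z -> S z K z -> (N <= K)%N ->
  local_conjugacy z K (gamma z) N' gamma.
Proof.
move=> [[delta [V [oV imE dK cg cd]] gx glim]] Sz Szz NK.
have [Q oQ SzK] := S_open Sz NK.
have Ssub : S z K `<=` S x N by rewrite SzK; exact: subIsetl.
have imS : gamma @` S z K `<=` gamma @` S x N by exact: image_subset.
split=> //.
- have /continuousP/(_ _ oQ)/open_subspaceP[V' oV' V'E] := cd.
  exists delta, (V `&` V'); split.
  + exact: openI.
  + have Sgz : S y N' (gamma z).
      have : (gamma @` S x N) (gamma z) by exists z.
      by rewrite imE => -[].
    rewrite (S_eq Sgz) setIA -imE; apply/seteqP; split.
      move=> _ [t St <-]; split; first by exists t => //; exact: Ssub.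
      have : (delta @^-1` Q `&` gamma @` S x N) (gamma t).
        split; last by exists t => //; exact: Ssub.
        by rewrite /= dK; [move: St; rewrite SzK => -[]|exact: Ssub].
      by rewrite -V'E => -[].
    move=> _ [[t St <-] V't]; exists t => //; rewrite SzK; split=> //.
    have : (V' `&` gamma @` S x N) (gamma t) by split=> //; exists t.
    by rewrite V'E => -[Qt _]; rewrite -(dK _ St).
  + by move=> t /Ssub; exact: dK.
  + exact: continuous_subspaceW cg.
  + exact: continuous_subspaceW cd.
- apply: (squeeze_cvgr _ (cvg_cst _) glim); apply: nearW => n; apply/andP; split.
    apply: le_trans (shift_dist_ge0 R (iter n phi z) (iter n phi (gamma z))) _.
    by apply: ub_le_sup; [exact: dist_ubound | exists z].
  apply: sup_le.
  + move=> _ [t St <-]; exists (shift_dist R (iter n phi t) (iter n phi (gamma t))).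
    by split=> //; exists t => //; exact: Ssub.
  + by exists (shift_dist R (iter n phi z) (iter n phi (gamma z))), z.
  + split; last exact: dist_ubound.
    by exists (shift_dist R (iter n phi z) (iter n phi (gamma z))), z.
Qed.

Lemma local_conjugacy_near x N y N' gamma z :
  local_conjugacy x N y N' gamma -> S x N z ->
  forall M, exists K0, forall K, (K0 <= K)%N -> forall t, S x N t -> S z K t ->
    forall n, (n < M)%N -> iter n phi (gamma t) 0 = iter n phi (gamma z) 0.
Proof.
move=> [[delta [V [oV imE dK cg cd]] gx glim]] Sz M.
have cgz : gamma @ within (S x N) (nbhs z) --> gamma z.
  by move/subspace_continuousP : cg; apply.
have nM : \forall t \near within (S x N) (nbhs z), forall n, (n < M)%N ->
    iter n phi (gamma t) 0 = iter n phi (gamma z) 0.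
  elim: M => [|M IH]; first by apply: nearW.
  have := cgz _ (phi_nbhs (gamma z) M); apply: filterS2 IH.
  move=> t IH eM n; rewrite ltnS leq_eqVlt => /orP[/eqP -> //|]; exact: IH.
have [K0 HK] := S_nbhs nM.
by exists K0 => K K0K t St SKt; exact: (HK K).
Qed.

Lemma local_conjugacy_tail x N y N' gamma :
  local_conjugacy x N y N' gamma ->
  exists M, forall n, (M <= n)%N -> forall t, S x N t ->
    iter n phi t 0 = iter n phi (gamma t) 0.
Proof.
move=> [_ _ /cvgr_lt /(_ 1 ltr01) [M _ HM]].
exists M => n Mn t St; apply/eqP; apply: contraPT (HM n Mn) => ne.
apply/negP; rewrite -leNgt.
have -> : 1 = shift_dist R (iter n phi t) (iter n phi (gamma t)).
  by rewrite /shift_dist (negbTE ne).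
by apply: ub_le_sup; [exact: dist_ubound | exists t].
Qed.

Lemma lc_basis_cover : \bigcup_(U in lc_basis) U = setT.
Proof.
apply/seteqP; split=> // g _; have /asboolP[P1 P2 [N [N' [gamma lg]]]] := valP g.
have [_ gx _] := lg; exists [set h | S (val g).1 N (val h).1 /\
    (val h).2 = gamma (val h).1].
  by exists (val g).1, N, N', gamma; rewrite gx.
by split=> //; exact: S_refl.
Qed.

Lemma lc_basis_join U V g : lc_basis U -> lc_basis V -> U g -> V g ->
  exists W, [/\ lc_basis W, W g & W `<=` U `&` V].
Proof.
move=> [x1 [N1 [N1' [g1 [Px1 Pgx1 lg1 ->]]]]] [x2 [N2 [N2' [g2 [Px2 Pgx2 lg2 ->]]]]].
move=> [/= S1 E1] [/= S2 E2]; have /asboolP[P1 P2 _] := valP g.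
set z := (val g).1 in S1 S2 E1 E2 P1 *.
have [M1 HM1] := local_conjugacy_tail lg1.
have [M2 HM2] := local_conjugacy_tail lg2.
have [K1 HK1] := local_conjugacy_near lg1 S1 (maxn M1 M2).
have [K2 HK2] := local_conjugacy_near lg2 S2 (maxn M1 M2).
pose K := maxn (maxn N1 N2) (maxn K1 K2).
have NK1 : (N1 <= K)%N by rewrite /K !leq_max leqnn.
have NK2 : (N2 <= K)%N by rewrite /K !leq_max leqnn orbT.
have KK1 : (K1 <= K)%N by rewrite /K !leq_max leqnn !orbT.
have KK2 : (K2 <= K)%N by rewrite /K !leq_max leqnn !orbT.
have sub1 : S z K `<=` S x1 N1.
  by have [Q _ ->] := S_open S1 NK1; exact: subIsetl.
have sub2 : S z K `<=` S x2 N2.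
  by have [Q _ ->] := S_open S2 NK2; exact: subIsetl.
have Szz : S z K z by exact: S_refl.
have img x N N' f (l : local_conjugacy x N (f x) N' f) t : S x N z -> S x N t ->
    S (f z) N' (f t).
  have [[delta [V' [_ imE _ _ _]]] _ _] := l => Sz St.
  have Im r : S x N r -> S (f x) N' (f r).
    move=> Sr; have : (f @` S x N) (f r) by exists r.
    by rewrite imE => -[].
  by rewrite (S_eq (Im _ Sz)); exact: Im.
exists [set h | S z K (val h).1 /\ (val h).2 = g1 (val h).1]; split=> //.
- exists z, K, N1', g1; split=> //; last exact: local_conjugacyW lg1 _ _ _.
  by rewrite -E1.
- move=> h [/= Sh Eh]; split; split=> //=; first exact: sub1.
    exact: sub2.
  rewrite Eh; set t := (val h).1 in Sh Eh *.
  have gz : g2 z = g1 z by rewrite -E1 -E2.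
  have St1 := img _ _ _ _ lg1 t S1 (sub1 _ Sh).
  have St2 := img _ _ _ _ lg2 t S2 (sub2 _ Sh).
  rewrite gz in St2; apply: S_sep St1 St2 _ => n.
  have [nM|Mn] := ltnP n (maxn M1 M2).
    rewrite (HK1 _ KK1 _ (sub1 _ Sh) Sh) // (HK2 _ KK2 _ (sub2 _ Sh) Sh) //.
    by rewrite gz.
  rewrite geq_max in Mn; case/andP: Mn => Mn1 Mn2.
  exact: etrans (esym (HM1 n Mn1 t (sub1 _ Sh))) (HM2 n Mn2 t (sub2 _ Sh)).
Qed.

End LocalConjugacy.

Section LcsLcu.
Context (R : realType) {A : finType}.
Notation T := (fullshift A).
Implicit Types (X : set T) (x p : T).

Definition Xu_loc X x (N : nat) : set T :=
  [set y | X y /\ forall n : int, n <= N%:Z -> y n = x n].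
Definition Xs_loc X x (N : nat) : set T :=
  [set y | X y /\ forall n : int, - N%:Z <= n -> y n = x n].

Definition Xu X p : set T :=
  [set x | X x /\ exists M : int, forall n, n <= M -> x n = p n].
Definition Xs X p : set T :=
  [set x | X x /\ exists M : int, forall n, M <= n -> x n = p n].

Lemma iter_shift n (x : T) i : iter n shift_map x i = x (i + n%:Z).
Proof.
elim: n i => [|n IH] i; first by rewrite addr0.
by rewrite iterS {1}/shift_map IH; congr (x _); lia.
Qed.

Lemma iter_unshift n (x : T) i : iter n unshift_map x i = x (i - n%:Z).
Proof.
elim: n i => [|n IH] i; first by rewrite subr0.
by rewrite iterS {1}/unshift_map IH; congr (x _); lia.
Qed.

Lemma Xu_loc_eq X x N z : Xu_loc X x N z -> Xu_loc X z N = Xu_loc X x N.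
Proof.
move=> [Xz zx]; apply/seteqP; split=> y [Xy yz]; split=> // n nN.
  by rewrite yz // zx.
by rewrite yz // zx.
Qed.

Lemma Xs_loc_eq X x N z : Xs_loc X x N z -> Xs_loc X z N = Xs_loc X x N.
Proof.
move=> [Xz zx]; apply/seteqP; split=> y [Xy yz]; split=> // n nN.
  by rewrite yz // zx.
by rewrite yz // zx.
Qed.

Lemma Xu_loc_refl X p x N : Xu X p x -> Xu_loc X x N x.
Proof. by case. Qed.

Lemma Xs_loc_refl X p x N : Xs X p x -> Xs_loc X x N x.
Proof. by case. Qed.

Lemma Xu_loc_open X x N z K : Xu_loc X x N z -> (N <= K)%N ->
  exists2 Q, open Q & Xu_loc X z K = Xu_loc X x N `&` Q.
Proof.
move=> [Xz zx] NK; eexists; first exact: (open_cylinder z K.+1).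
apply/seteqP; split=> [y [Xy yz]|y [[Xy yx] yz]].
  split; first by split=> // n nN; rewrite yz ?zx //; lia.
  by move=> i iK; apply: yz; lia.
split=> // n nK; have [nN|Nn] := lerP n N%:Z; first by rewrite yx ?zx.
by apply: yz; lia.
Qed.

Lemma Xs_loc_open X x N z K : Xs_loc X x N z -> (N <= K)%N ->
  exists2 Q, open Q & Xs_loc X z K = Xs_loc X x N `&` Q.
Proof.
move=> [Xz zx] NK; eexists; first exact: (open_cylinder z K.+1).
apply/seteqP; split=> [y [Xy yz]|y [[Xy yx] yz]].
  split; first by split=> // n nN; rewrite yz ?zx //; lia.
  by move=> i iK; apply: yz; lia.
split=> // n nK; have [nN|Nn] := lerP (- N%:Z) n; first by rewrite yx ?zx.
by apply: yz; lia.
Qed.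

Lemma Xu_loc_nbhs X (z : T) U : nbhs z U ->
  exists K0, forall K, (K0 <= K)%N -> Xu_loc X z K `<=` U.
Proof.
move=> /cylinder_base[M HM]; exists M => K MK y [_ yz].
by apply: HM => i iM; apply: yz; lia.
Qed.

Lemma Xs_loc_nbhs X (z : T) U : nbhs z U ->
  exists K0, forall K, (K0 <= K)%N -> Xs_loc X z K `<=` U.
Proof.
move=> /cylinder_base[M HM]; exists M => K MK y [_ yz].
by apply: HM => i iM; apply: yz; lia.
Qed.

Lemma Xu_loc_sep X w N1 N2 u v : Xu_loc X w N1 u -> Xu_loc X w N2 v ->
  (forall n, iter n shift_map u 0 = iter n shift_map v 0) -> u = v.
Proof.
move=> [_ uw] [_ vw] uv; apply/funext => i; have [i0|i0] := lerP i 0.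
  by rewrite uw ?vw //; lia.
have := uv `|i|%N; rewrite !iter_shift.
by have -> : 0 + `|i|%N%:Z = i by lia.
Qed.

Lemma Xs_loc_sep X w N1 N2 u v : Xs_loc X w N1 u -> Xs_loc X w N2 v ->
  (forall n, iter n unshift_map u 0 = iter n unshift_map v 0) -> u = v.
Proof.
move=> [_ uw] [_ vw] uv; apply/funext => i; have [i0|i0] := lerP 0 i.
  by rewrite uw ?vw //; lia.
have := uv `|i|%N; rewrite !iter_unshift.
by have -> : 0 - `|i|%N%:Z = i by lia.
Qed.

Lemma shift_nbhs (w : T) n :
  nbhs w [set u | iter n shift_map u 0 = iter n shift_map w 0].
Proof.
by apply: filterS (nbhs_coord w (0 + n%:Z)) => u; rewrite /= !iter_shift.
Qed.

Lemma unshift_nbhs (w : T) n :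
  nbhs w [set u | iter n unshift_map u 0 = iter n unshift_map w 0].
Proof.
by apply: filterS (nbhs_coord w (0 - n%:Z)) => u; rewrite /= !iter_unshift.
Qed.

Section Arrows.
Variables (X : set T) (p : T).

Definition lcs_arrow := lc_arrow R (Xu_loc X) shift_map (Xu X p).
Definition lcu_arrow := lc_arrow R (Xs_loc X) unshift_map (Xs X p).

HB.instance Definition _ := Choice.on lcs_arrow.
HB.instance Definition _ := Choice.on lcu_arrow.

HB.instance Definition _ := isBaseTopological.Build lcs_arrow
  (@lc_basis_cover R A (Xu_loc X) shift_map (Xu X p) (@Xu_loc_refl X p))
  (lc_basis_join (@Xu_loc_eq X) (@Xu_loc_refl X p) (@Xu_loc_open X)
    (@Xu_loc_nbhs X) (@Xu_loc_sep X) shift_nbhs).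

HB.instance Definition _ := isBaseTopological.Build lcu_arrow
  (@lc_basis_cover R A (Xs_loc X) unshift_map (Xs X p) (@Xs_loc_refl X p))
  (lc_basis_join (@Xs_loc_eq X) (@Xs_loc_refl X p) (@Xs_loc_open X)
    (@Xs_loc_nbhs X) (@Xs_loc_sep X) unshift_nbhs).

Definition Glcs : topGroupoid :=
  @TopGroupoid lcs_arrow (@lc_prod R A (Xu_loc X) shift_map (Xu X p)).
Definition Glcu : topGroupoid :=
  @TopGroupoid lcu_arrow (@lc_prod R A (Xs_loc X) unshift_map (Xs X p)).

End Arrows.

End LcsLcu.

(** * Bratteli diagrams *)

(* Levels are counted from the initial one: [vert B m] and [edge B m] are
   V_(n_0 + m) and E_(n_0 + m). *)
Record bratteli := Bratteli {
  vert : nat -> finType;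
  edge : nat -> finType;
  init : forall n, edge n -> vert n;
  term : forall n, edge n -> vert n.+1
}.

Section BratteliGroupoid.
Variable B : bratteli.

Definition bpath : Type :=
  {e : forall n, edge B n | `[< forall n, term (e n) = init (e n.+1) >]}.

Definition tail_arrow : Type := {g : bpath * bpath |
  `[< exists m, forall n, (m <= n)%N -> val g.1 n = val g.2 n >]}.

HB.instance Definition _ := Choice.copy tail_arrow {g : bpath * bpath |
  `[< exists m, forall n, (m <= n)%N -> val g.1 n = val g.2 n >]}.

Definition tail_prod (g h k : tail_arrow) := pair_prod (val g) (val h) (val k).

(* The arrows (f, (e'_0, .., e'_(m-1), f_m, f_(m+1), ..)) with f in the
   cylinder of e_0, .., e_(m-1). *)
Definition tail_cylinder (e e' : bpath) (m : nat) : set tail_arrow :=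
  [set g | (forall n, (n < m)%N ->
              val (val g).1 n = val e n /\ val (val g).2 n = val e' n) /\
           (forall n, (m <= n)%N -> val (val g).2 n = val (val g).1 n)].

Definition tail_basis : set (set tail_arrow) :=
  [set U | exists e e' m,
    (forall n, (m <= n)%N -> val e n = val e' n) /\ U = tail_cylinder e e' m].

Lemma tail_basis_cover : \bigcup_(U in tail_basis) U = setT.
Proof.
apply/seteqP; split=> // g _; have /asboolP[m gm] := valP g.
exists (tail_cylinder (val g).1 (val g).2 m).
  by exists (val g).1, (val g).2, m.
by split=> [n _|n mn]; [|rewrite gm].
Qed.

Lemma tail_basis_join U V g : tail_basis U -> tail_basis V -> U g -> V g ->
  exists W, [/\ tail_basis W, W g & W `<=` U `&` V].
Proof.
move=> [e1 [e1' [m1 [_ ->]]]] [e2 [e2' [m2 [_ ->]]]] [a1 b1] [a2 b2].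
have b : forall n, (maxn m1 m2 <= n)%N -> val (val g).1 n = val (val g).2 n.
  by move=> n; rewrite geq_max => /andP[nm1 _]; rewrite b1.
exists (tail_cylinder (val g).1 (val g).2 (maxn m1 m2)); split.
- by exists (val g).1, (val g).2, (maxn m1 m2).
- by split=> // n mn; rewrite b.
- have sub e e' m : (m <= maxn m1 m2)%N -> tail_cylinder e e' m g ->
      tail_cylinder (val g).1 (val g).2 (maxn m1 m2) `<=` tail_cylinder e e' m.
    move=> mm [a ab] h [c d]; split=> n nm.
      have [-> ->] := c n (leq_trans nm mm); exact: a.
    have [nm'|mn] := ltnP n (maxn m1 m2); last exact: d.
    by have [-> ->] := c n nm'; exact: ab.
  move=> h hh; split; first by apply: (sub _ _ _ (leq_maxl _ _)) hh; split.
  by apply: (sub _ _ _ (leq_maxr _ _)) hh; split.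
Qed.

HB.instance Definition _ := isBaseTopological.Build tail_arrow
  tail_basis_cover tail_basis_join.

Definition bratteli_groupoid := TopGroupoid tail_prod.

End BratteliGroupoid.

(** * Increasing unions of groupoids *)

(* [incl N] is the graph of the inclusion of the [N]-th groupoid in the next
   one. *)
Record groupoid_sequence := GroupoidSequence {
  stage : nat -> topGroupoid;
  incl : forall N, stage N -> stage N.+1 -> Prop
}.

Section Union.
Local Open Scope quotient_scope.
Variable G : groupoid_sequence.

Inductive incl_step : {N & stage G N} -> {N & stage G N} -> Prop :=
  InclStep N (g : stage G N) (h : stage G N.+1) of incl g h :
    incl_step (existT _ N g) (existT _ N.+1 h).

Definition union_rel (u v : {N & stage G N}) : bool :=
  `[< clos_refl_sym_trans _ incl_step u v >].

Lemma union_rel_equiv : equiv_class_of union_rel.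
Proof.
split.
- by move=> u; apply/asboolP; exact: rst_refl.
- by move=> u v; apply/asboolP/asboolP; exact: rst_sym.
- move=> v u w /asboolP uv /asboolP vw; apply/asboolP.
  exact: rst_trans uv vw.
Qed.

Canonical union_equiv := EquivRelPack union_rel_equiv.

(* The topology is the quotient of the disjoint union topology, i.e. the
   inductive limit topology. *)
Definition union_space : topologicalType :=
  quotient_topology {eq_quot union_equiv}.

Definition to_union N (g : stage G N) : union_space :=
  \pi_({eq_quot union_equiv}) (existT _ N g).

Definition union_prod (a b c : union_space) :=
  exists N (g h k : stage G N),
    [/\ a = to_union g, b = to_union h, c = to_union k & gprod g h k].

Definition union_groupoid := TopGroupoid union_prod.

End Union.

(** * The diagrams of follower and predecessor sets *)

Section FollowerDiagram.
Context {A : finType}.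
(* [F w] is the set of words by which [w] can be extended, and [ext w a] is [w]
   extended by the letter [a]: on the right for lcs, on the left for lcu. *)
Variables (F : seq A -> set (seq A)) (ext : seq A -> A -> seq A).

Definition follower_class n (w : seq A) : {set n.-tuple A} :=
  finset (fun v : n.-tuple A => `[< F [::] v /\ F v = F w >]).

Definition follower_vertex n : finType := {C : {set n.-tuple A} |
  `[< exists2 w : n.-tuple A, F [::] w & C = follower_class n w >]}.

(* The edge labelled a leaving the class [w] is the triple formed by [w], a and
   the class of [w] extended by a. *)
Definition follower_edge n : finType :=
  {e : follower_vertex n * A * follower_vertex n.+1 |
    `[< exists w : n.-tuple A,
         [/\ F [::] w, val e.1.1 = follower_class n w, F w [:: e.1.2]
           & val e.2 = follower_class n.+1 (ext w e.1.2)] >]}.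

Definition follower_diagram : bratteli :=
  @Bratteli follower_vertex follower_edge
    (fun n e => (val e).1.1) (fun n e => (val e).2).

Definition label (e : bpath follower_diagram) (n : nat) : A :=
  (val (val e n : follower_edge n)).1.2.

End FollowerDiagram.

Definition prefix_path (A : finType) (F F' : seq A -> set (seq A)) ext (a : A)
    (e : bpath (follower_diagram F ext)) (e' : bpath (follower_diagram F' ext)) :=
  label e' 0%N = a /\ forall n, label e' n.+1 = label e n.

(* The graph of the inclusion of path groupoids that prefixes the label [a] to
   both paths; a path in these diagrams is determined by its labels. *)
Definition prefix_arrow (A : finType) (F F' : seq A -> set (seq A)) ext (a : A)
    (g : bratteli_groupoid (follower_diagram F ext))
    (h : bratteli_groupoid (follower_diagram F' ext)) :=
  prefix_path a (val g).1 (val h).1 /\ prefix_path a (val g).2 (val h).2.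

Section LcsLcuDiagrams.
Context {A : finType}.
Implicit Types (X : set (fullshift A)) (p : fullshift A).

(* A choice of k >= N such that p_[-k, -N] (resp. p_[N, k]) is synchronizing;
   the junk value N is used when there is none. *)
Definition lcs_cut X p (N : nat) : nat := xget N
  [set k | (N <= k)%N /\ synchronizing_word X (factor p (- k%:Z) (k - N).+1)].
Definition lcu_cut X p (N : nat) : nat := xget N
  [set k | (N <= k)%N /\ synchronizing_word X (factor p N%:Z (k - N).+1)].

(* E^+(p_(-oo, -N] w) and E^-(w p_[N, +oo)). *)
Definition Eplus_past X p N w : set (seq A) :=
  Eplus X (factor p (- (lcs_cut X p N)%:Z) (lcs_cut X p N - N).+1 ++ w).
Definition Eminus_future X p N w : set (seq A) :=
  Eminus X (w ++ factor p N%:Z (lcu_cut X p N - N).+1).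

Definition Blcs X p N := follower_diagram (Eplus_past X p N) rcons.
Definition Blcu X p N :=
  follower_diagram (Eminus_future X p N) (fun w a => a :: w).

Definition Blcs_union X p : topGroupoid := union_groupoid
  (@GroupoidSequence (fun N => bratteli_groupoid (Blcs X p N))
    (fun N => prefix_arrow (p (- N%:Z)))).
Definition Blcu_union X p : topGroupoid := union_groupoid
  (@GroupoidSequence (fun N => bratteli_groupoid (Blcu X p N))
    (fun N => prefix_arrow (p N%:Z))).

End LcsLcuDiagrams.

(* Main.v *)
Require Import Defs.
From mathcomp Require Import all_boot all_order all_algebra.
From mathcomp Require Import all_classical all_reals all_analysis.
From mathcomp Require Import generic_quotient zify.
From Stdlib Require Import Relation_Operators.
Import Defs.

(* Say that x and y are twins at M if they agree to the right of M and the left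
   rays x_(-oo, M], y_(-oo, M] have the same right completions in X.  Uniform
   convergence of a stable local conjugacy gamma from x to y forces
   gamma(z)_n = z_n for all large n, uniformly in z; together with continuity
   at x this shows that near x the map gamma is
   z |-> y_(-oo, M] z_(M, oo) for every large M, whence x and y are twins at M.
   Conversely such a splicing of twins is a local conjugacy.  On the other side,
   since p_[-k, -N] is synchronizing, the paths of the N-th diagram are the
   points of X that agree with p on (-oo, -N], a finite word extends
   p_(-oo, -N] w in X exactly when it lies in E^+(p_[-k, -N] w), and two paths
   are tail equivalent exactly when their points are twins.  Splicing graphs
   correspond to the basic cylinders of the path groupoids.  The unstable case
   is the stable one read through the reflection n |-> -n. *)

Set Implicit Arguments.
Unset Strict Implicit.
Unset Printing Implicit Defensive.

Import Order.TTheory GRing.Theory Num.Theory.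
Import numFieldNormedType.Exports.

Local Open Scope classical_set_scope.
Local Open Scope ring_scope.

(** * Words and synchronization *)

Section Words.
Context {A : finType}.
Notation T := (fullshift A).
Implicit Types (X : set T) (x y z q : T) (u v w : seq A).

Definition splice y z (M : int) : T := fun i => if i <= M then y i else z i.
Definition translate x (t : int) : T := fun i => x (i + t).
Definition flip x : T := fun i => x (- i).

(** Closedness and shift invariance in coordinate form. Both pass through the reflection without any
    topological argument, which serves the unstable case. *)
Definition cylinder_closed X := forall x,
  (forall M : nat, exists2 y, X y & forall i : int, `|i| < M%:Z -> y i = x i) ->
  X x.
Definition translation_invariant X := forall x t, X x -> X (translate x t).

Lemma size_factor x i n : size (factor x i n) = n.
Proof. by rewrite size_map size_iota. Qed.

Lemma nth_factor a x i n k : (k < n)%N -> nth a (factor x i n) k = x (i + k%:Z).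
Proof. by move=> kn; rewrite (nth_map 0%N) ?size_iota // nth_iota. Qed.

Lemma factorP x y i j n : factor x i n = factor y j n <->
  forall k, (k < n)%N -> x (i + k%:Z) = y (j + k%:Z).
Proof.
split=> [e k kn|e]; first by rewrite -(nth_factor (x 0) _ _ kn) e nth_factor.
apply: (@eq_from_nth _ (x 0)); rewrite ?size_factor // => k kn.
by rewrite !nth_factor // e.
Qed.

Lemma factorD x i m n :
  factor x i (m + n) = factor x i m ++ factor x (i + m%:Z) n.
Proof.
rewrite /factor iotaD map_cat add0n; congr (_ ++ _).
rewrite -[m in iota m n]addn0 iotaDl -map_comp; apply: eq_map => k /=.
by congr (x _); lia.
Qed.

Lemma factorS x i n : factor x i n.+1 = rcons (factor x i n) (x (i + n%:Z)).
Proof. by rewrite -addn1 factorD cats1 /factor /= addr0. Qed.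

Lemma factor_translate x t i n : factor (translate x t) i n = factor x (i + t) n.
Proof. by apply/factorP => k _; rewrite /translate; congr (x _); lia. Qed.

Lemma factor_flip x i n : factor (flip x) i n = rev (factor x (1 - i - n%:Z) n).
Proof.
apply: (@eq_from_nth _ (x 0)) => [|k]; first by rewrite size_rev !size_factor.
rewrite size_factor => kn; rewrite nth_rev size_factor // !nth_factor //.
  by congr (x _); lia.
lia.
Qed.

Lemma shift_space_closed X : shift_space X -> cylinder_closed X.
Proof.
move=> [cX _] x Hx; apply: cX => B /cylinder_base[M HM].
by have [y Xy yx] := Hx M; exists y; split=> //; exact: HM.
Qed.

Lemma shift_space_invariant X : shift_space X -> translation_invariant X.
Proof.
move=> [_ sX].
have fwd x (n : nat) : X x -> X (translate x n%:Z).
  move=> Xx; elim: n => [|n IH].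
    by rewrite (_ : translate x _ = x) //; apply/funext => i; congr (x _); lia.
  rewrite -sX; exists (translate x n%:Z) => //; apply/funext => i.
  by congr (x _); lia.
have bwd x (n : nat) : X x -> X (translate x (- n%:Z)).
  move=> Xx; elim: n => [|n IH].
    by rewrite (_ : translate x _ = x) //; apply/funext => i; congr (x _); lia.
  move: IH; rewrite -{1}sX => -[y Xy yx].
  rewrite (_ : translate x _ = y) //; apply/funext => i.
  have := congr1 (fun z : T => z (i - 1)) yx; rewrite /= /shift_map subrK => ->.
  by congr (x _); lia.
move=> x t Xx; have [t0|t0] := lerP 0 t.
  by rewrite -[t]gez0_abs //; exact: fwd.
by rewrite (_ : t = - `|t|%N%:Z); [exact: bwd | lia].
Qed.

Section Invariant.
Variable X : set T.
Hypothesis X_inv : translation_invariant X.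

Lemma language_at w i :
  language X w <-> exists2 x, X x & factor x i (size w) = w.
Proof.
split=> [[x Xx [j ->]]|[x Xx <-]].
  exists (translate x (j - i)); first exact: X_inv.
  by rewrite factor_translate size_factor; congr factor; lia.
by exists x => //; exists i; rewrite size_factor.
Qed.

Lemma language_factor x i n : X x -> language X (factor x i n).
Proof. by move=> Xx; exists x => //; exists i; rewrite size_factor. Qed.

Lemma language_catl u v : language X (u ++ v) -> language X u.
Proof.
move=> /(language_at _ 0)[x Xx]; rewrite size_cat factorD => /eqP.
rewrite eqseq_cat ?size_factor // => /andP[/eqP <- _]; exact: language_factor.
Qed.

Lemma language_catr u v : language X (u ++ v) -> language X v.
Proof.
move=> /(language_at _ 0)[x Xx]; rewrite size_cat factorD => /eqP.
rewrite eqseq_cat ?size_factor // => /andP[_ /eqP <-]; exact: language_factor.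
Qed.

(** The words [a u w] and [w v b] overlap exactly in [w], so synchronization of [w] alone glues
    them. *)
Lemma synchronizing_word_extend u w v : synchronizing_word X w ->
  language X (u ++ w ++ v) -> synchronizing_word X (u ++ w ++ v).
Proof.
move=> [_ sw] L; split=> // a b La Lb.
have {}La : language X ((a ++ u) ++ w).
  by move: La; rewrite !catA => /language_catl.
have {}Lb : language X (w ++ (v ++ b)).
  by move: Lb; rewrite -!catA => /language_catr.
by have := sw _ _ La Lb; rewrite !catA.
Qed.

Hypothesis X_closed : cylinder_closed X.

(* Any window of the spliced point is u w v with w the synchronizing word, u w a
   word of y and w v a word of z. *)
Lemma splice_synchronizing y z (i : int) (n : nat) :
  X y -> X z -> synchronizing_word X (factor y i n) ->
  factor y i n = factor z i n -> X (splice y z (i + n%:Z - 1)).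
Proof.
move=> Xy Xz [_ sw] yz; apply: X_closed => K.
(* The lengths [a] and [l] make the window from [i - a] to [i + n + l] cover all coordinates of
   absolute value below [K]. *)
have [a aE] : exists a, a = (K + `|i|%N)%N by eexists.
have [l lE] : exists l, l = (K + `|(i + n%:Z)%R|%N)%N by eexists.
have L1 : language X (factor y (i - a%:Z) a ++ factor y i n).
  rewrite -{2}(subrK a%:Z i) -factorD; exact: language_factor.
have L2 : language X (factor y i n ++ factor z (i + n%:Z) l).
  rewrite yz -factorD; exact: language_factor.
have /(language_at _ (i - a%:Z))[x Xx] := sw _ _ L1 L2.
set s := splice y z _.
suff -> : factor y (i - a%:Z) a ++ factor y i n ++ factor z (i + n%:Z) l =
    factor s (i - a%:Z) (a + (n + l)).
  rewrite size_factor => /factorP e; exists x => // j jK.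
  have := e `|(j - (i - a%:Z))%R|%N; rewrite (_ : i - a%:Z + _ = j); last by lia.
  apply; lia.
rewrite factorD subrK (factorD s i); congr (_ ++ (_ ++ _)).
- by apply/factorP => k kn; rewrite /s /splice ifT //; lia.
- by apply/factorP => k kn; rewrite /s /splice ifT //; lia.
- by apply/factorP => k kn; rewrite /s /splice ifF //; lia.
Qed.

(* The word to the left of w may be prolonged to the whole past of q, because it
   is synchronizing. *)
Lemma language_past q (N k : nat) w : X q -> (N <= k)%N ->
  synchronizing_word X (factor q (- k%:Z) (k - N).+1) ->
  language X (factor q (- k%:Z) (k - N).+1 ++ w) <->
  exists x, [/\ X x, forall n : int, n <= - N%:Z -> x n = q n
    & factor x (1 - N%:Z) (size w) = w].
Proof.
move=> Xq Nk sy; have kN : - k%:Z + (k - N).+1%:Z = 1 - N%:Z by lia.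
split=> [/(language_at _ (- k%:Z))[z Xz]|[x [Xx xq xw]]].
  rewrite size_cat size_factor factorD => /eqP.
  rewrite eqseq_cat ?size_factor // kN => /andP[/eqP zq /eqP zw].
  have := splice_synchronizing Xq Xz sy (esym zq); rewrite kN => Xs.
  exists (splice q z (1 - N%:Z - 1)); split=> //.
    by move=> n nN; rewrite /splice ifT //; lia.
  by rewrite -[RHS]zw; apply/factorP => i _; rewrite /splice ifF //; lia.
suff -> : factor q (- k%:Z) (k - N).+1 ++ w =
  factor x (- k%:Z) ((k - N).+1 + size w) by exact: language_factor.
rewrite factorD kN xw; congr (_ ++ _); apply/factorP => i ik.
by rewrite xq //; lia.
Qed.

(** Periodicity moves an occurrence of a synchronizing word as far to the left as desired; the
    window from there to [-N] contains it and is therefore synchronizing. *)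
Lemma periodic_synchronizing q (d : nat) : X q -> (0 < d)%N ->
  (forall i : int, q (i + d%:Z) = q i) -> synchronizing_point X q ->
  forall N, exists k, (N <= k)%N /\
    synchronizing_word X (factor q (- k%:Z) (k - N).+1).
Proof.
move=> Xq d0 qd [w sw [i wi]] N.
have qt (t : nat) j : q (j - (t * d)%N%:Z) = q j.
  elim: t => [|t IH]; first by rewrite mul0n subr0.
  by rewrite -IH -[LHS]qd; congr (q _); rewrite mulSn; lia.
(* As [t <= t * d], moving left by [t] periods brings the whole occurrence of [w] to the left of
   [-N]. It then starts at [-k], at the beginning of the window. *)
have [t tE] : exists t, t = (N + `|i|%N + size w)%N by eexists.
have [k kE] : exists k, k = `|(i - (t * d)%N%:Z)%R|%N by eexists.
have td : (t <= t * d)%N by rewrite leq_pmulr.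
have wk : factor q (- k%:Z) (size w) = w.
  rewrite [RHS]wi; apply/factorP => j _; rewrite -[RHS](qt t); congr (q _); lia.
exists k; split; first lia.
have -> : (k - N).+1 = (0 + (size w + ((k - N).+1 - size w)))%N by lia.
rewrite factorD factorD addr0 wk; apply: synchronizing_word_extend => //.
rewrite -{1}wk -factorD; exact: language_factor.
Qed.

End Invariant.

(** * Reflection of shift spaces *)

Lemma flipK x : flip (flip x) = x.
Proof. by apply/funext => i; rewrite /flip opprK. Qed.

Lemma flip_closed X : cylinder_closed X -> cylinder_closed [set x | X (flip x)].
Proof.
move=> cX x Hx; apply: cX => M; have [y Xy yx] := Hx M.
by exists (flip y) => // i iM; rewrite /flip yx //; lia.
Qed.

Lemma flip_invariant X :
  translation_invariant X -> translation_invariant [set x | X (flip x)].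
Proof.
move=> iX x t Xx /=; rewrite (_ : flip _ = translate (flip x) (- t)).
  exact: iX.
by apply/funext => i; congr (x _); lia.
Qed.

Lemma language_flip X w :
  language [set x | X (flip x)] w <-> language X (rev w).
Proof.
have fl X' v : language X' v -> language [set x | X' (flip x)] (rev v).
  move=> [x Xx [i ->]]; exists (flip x); first by rewrite /= flipK.
  exists (1 - i - (size v)%:Z).
  by rewrite factor_flip !size_rev !size_factor; congr (rev (factor _ _ _)); lia.
split=> [/fl|/fl]; rewrite ?revK //.
by congr (language _ _); apply/funext => x /=; rewrite flipK.
Qed.

Lemma synchronizing_word_flip X w :
  synchronizing_word X (rev w) -> synchronizing_word [set x | X (flip x)] w.
Proof.
move=> [L sw]; split; first exact/language_flip.
move=> u v /language_flip; rewrite rev_cat => Lu.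
move=> /language_flip; rewrite rev_cat => Lv; apply/language_flip.
by rewrite !rev_cat -catA; exact: sw.
Qed.

Lemma synchronizing_point_flip X x : synchronizing_point X x ->
  synchronizing_point [set x | X (flip x)] (flip x).
Proof.
move=> [w sw [i wi]]; exists (rev w).
  by apply: synchronizing_word_flip; rewrite revK.
exists (1 - i - (size w)%:Z); rewrite factor_flip size_rev [LHS](congr1 rev wi).
by congr (rev (factor _ _ _)); lia.
Qed.

End Words.

(** * Splicing and paths of the follower diagrams *)

Section Twins.
Context {A : finType}.
Notation T := (fullshift A).
Variable Y : set T.
Implicit Types (x y z : T) (M : int).

Definition twin M x y := (forall n, M < n -> x n = y n) /\
  forall z, (forall n, n <= M -> z n = x n) -> (Y z <-> Y (splice y z M)).

Lemma splice_splice x y z M : splice x (splice y z M) M = splice x z M.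
Proof. by apply/funext => n; rewrite /splice; case: (n <= M). Qed.

Lemma splice_id x z M : (forall n, n <= M -> z n = x n) -> splice x z M = z.
Proof. by move=> zx; apply/funext => n; rewrite /splice; case: ifP => // /zx. Qed.

Lemma splice_twin M x y : twin M x y -> splice y x M = y.
Proof.
move=> [xy _]; apply/funext => n; rewrite /splice; case: ifPn => //.
by rewrite -ltNge => /xy.
Qed.

Lemma twin_sym M x y : twin M x y -> twin M y x.
Proof.
move=> [xy H]; split=> [n /xy //|z zy].
have := H (splice x z M); rewrite splice_splice (splice_id zy) => -> //.
by move=> n nM; rewrite /splice nM.
Qed.

(** Between [M] and [M'] the point [z] follows [x], and there [x] agrees with [y], so moving the cut
    changes no coordinate. *)
Lemma splice_le M M' x y z : twin M x y -> M <= M' ->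
  (forall n, n <= M' -> z n = x n) -> splice y z M' = splice y z M.
Proof.
move=> [xy _] MM' zx; apply/funext => n; rewrite /splice.
have [nM|Mn] := lerP n M; first by rewrite (le_trans nM).
by case: ifPn => // nM'; rewrite zx // xy.
Qed.

Lemma twin_le M M' x y : twin M x y -> M <= M' -> twin M' x y.
Proof.
move=> xyM MM'; split=> [n M'n|z zx].
  by apply: xyM.1; exact: le_lt_trans M'n.
rewrite (splice_le xyM MM' zx); apply: xyM.2 => n nM; apply: zx.
exact: le_trans MM'.
Qed.

(** The condition on completions concerns only left rays, and [z] and its splice inherit those of
    [x] and [y]. *)
Lemma twin_graph M x y z : twin M x y -> (forall n, n <= M -> z n = x n) ->
  twin M z (splice y z M).
Proof.
move=> xy zx; split=> [n Mn|t tz]; first by rewrite /splice leNgt Mn.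
have -> : splice (splice y z M) t M = splice y t M.
  by apply/funext => n; rewrite /splice; case: (n <= M).
by apply: xy.2 => n nM; rewrite tz ?zx.
Qed.

(** The common ground of the comparison: the arrows of the conjugacy groupoid and those of the union
    of path groupoids are both identified with these pairs of points. *)
Definition arrow_pair (q : T) (u : T * T) :=
  [/\ (exists M : int, forall n, n <= M -> u.1 n = q n),
      (exists M : int, forall n, n <= M -> u.2 n = q n),
      Y u.1, Y u.2 & exists m : nat, twin m%:Z u.1 u.2].

(** For [u.1] and [u.2] twins at [m], these graphs give the neighbourhoods of [u] in both
    topologies. *)
Definition splice_graph (u : T * T) (m : nat) (v : T * T) :=
  (forall n : int, n <= m%:Z -> v.1 n = u.1 n) /\
  v.2 = splice u.2 v.1 m%:Z.

End Twins.

(** * Paths as points with prescribed past *)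

Section Paths.
Context {A : finType}.
Notation T := (fullshift A).
Variables (Y : set T) (q : T) (N : nat).
Variables (F : seq A -> set (seq A)) (ext : seq A -> A -> seq A).
(* [o] turns the label sequence of a path into the word that the diagram stores:
   the identity for lcs, the reversal for lcu. *)
Variable o : seq A -> seq A.
Hypotheses (oK : involutive o) (size_o : forall w, size (o w) = size w).
Hypotheses (o_seq1 : forall a, o [:: a] = [:: a]).
Hypothesis ext_o : forall w a, ext (o w) a = o (rcons w a).
Hypothesis Y_closed : cylinder_closed Y.
(** Synchronization makes the follower set of the finite cut word that of the whole ray of [q] up to
    [-N]. In this form the choice of the cut has disappeared. *)
Hypothesis F_o : forall w v, F (o w) (o v) <->
  exists x, [/\ Y x, forall n : int, n <= - N%:Z -> x n = q n
    & factor x (1 - N%:Z) (size (w ++ v)) = w ++ v].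

Notation B := (follower_diagram F ext).
Implicit Types (e f : bpath B) (x y z : T) (w v : seq A).

Definition edge_at e n : follower_edge F ext n := val e n.
Definition source e n : {set n.-tuple A} := val (val (edge_at e n)).1.1.
Definition labels e n := [seq label e k | k <- iota 0 n].
Definition path_point e : T :=
  fun i => if i <= - N%:Z then q i else label e `|(i + N%:Z - 1)%R|%N.

Lemma o_nil : o [::] = [::].
Proof. by apply/size0nil; rewrite size_o. Qed.

Lemma F_nil w : F [::] (o w) <-> F (o w) (o [::]).
Proof. by rewrite -{1}o_nil !F_o cats0. Qed.

Lemma F_cons w a v : F (o w) (o (a :: v)) <-> F (o (rcons w a)) (o v).
Proof. by rewrite !F_o cat_rcons. Qed.

(** Continuing [w a] by [v] is continuing [w] by [a v]. Hence the target of an edge does not depend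
    on the representative of its source. *)
Lemma F_rcons w w' a :
  F (o w) = F (o w') -> F (o (rcons w a)) = F (o (rcons w' a)).
Proof.
move=> e; apply/funext => v; rewrite -(oK v); apply/propext.
by rewrite -!F_cons e.
Qed.

Lemma F_prefix w a : F (o w) [:: a] <-> F [::] (o (rcons w a)).
Proof. by rewrite -o_seq1 F_cons F_nil. Qed.

Lemma follower_class_eq n w w' : F w = F w' ->
  follower_class F n w = follower_class F n w'.
Proof. by move=> e; apply/setP => v; rewrite !inE e. Qed.

(** Being admissible, [w] lies in its own class and hence in that of [w']. *)
Lemma follower_class_inj n w w' : size w = n -> F [::] w ->
  follower_class F n w = follower_class F n w' -> F w = F w'.
Proof.
move=> sw Fw; have swP : size w == n by apply/eqP.
move=> /setP /(_ (Tuple swP)); rewrite !inE asboolT /=; last by split.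
by move=> /esym /asboolP[].
Qed.

Lemma size_labels e n : size (labels e n) = n.
Proof. by rewrite size_map size_iota. Qed.

Lemma labelsS e n : labels e n.+1 = rcons (labels e n) (label e n).
Proof. by rewrite /labels -addn1 iotaD map_cat cats1. Qed.

Lemma target_eq e n : val (val (edge_at e n)).2 = source e n.+1.
Proof. by have /asboolP/(_ n) := valP e => /= /(congr1 val). Qed.

(** An edge only provides some representative of its source, not the word read so far. The two have
    equal follower sets, and [F_rcons] carries this across the edge. Consequently a path is
    determined by its labels. *)
Lemma source_labels e n : F [::] (o (labels e n)) /\
  source e n = follower_class F n (o (labels e n)).
Proof.
elim: n => [|n [IHF IHs]].
  have /asboolP[w [Fw sw _ _]] := valP (edge_at e 0%N).
  rewrite /labels /= o_nil.
  have w0 : tval w = [::] by apply/size0nil; rewrite size_tuple.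
  by rewrite -w0; split=> //; rewrite w0; rewrite w0 in Fw.
have /asboolP[w [Fw sw Fa tw]] := valP (edge_at e n).
have e1 : F w = F (o (labels e n)).
  by apply: (@follower_class_inj n); rewrite ?size_tuple // -sw.
rewrite labelsS -F_prefix -e1; split=> //.
rewrite -target_eq tw; apply: follower_class_eq.
by rewrite -(oK w) ext_o; apply: F_rcons; rewrite oK.
Qed.

Lemma edge_at_eq e f n : source e n = source f n -> label e n = label f n ->
  source e n.+1 = source f n.+1 -> val e n = val f n.
Proof.
rewrite -!target_eq /source /label /edge_at => s l t; apply/val_inj.
case: (val (val e n : follower_edge F ext n)) s l t => -[s1 l1] t1.
case: (val (val f n : follower_edge F ext n)) => -[s2 l2] t2 /=.
by move=> /val_inj -> -> /val_inj ->.
Qed.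

Lemma path_point_past e (n : int) : n <= - N%:Z -> path_point e n = q n.
Proof. by rewrite /path_point => ->. Qed.

Lemma path_point_label e k : path_point e (1 - N%:Z + k%:Z) = label e k.
Proof. by rewrite /path_point ifF; [congr label; lia|lia]. Qed.

Lemma factor_path_point e n : factor (path_point e) (1 - N%:Z) n = labels e n.
Proof. by apply: eq_map => k; exact: path_point_label. Qed.

(** By [F_o] every initial word of labels, placed after the past of [q], is completed by a point of
    [Y]; closedness gives the limit. The first [M + N] labels reach position [M]. *)
Lemma path_point_in e : Y (path_point e).
Proof.
apply: Y_closed => M; have [/F_nil + _] := source_labels e (M + N).
rewrite F_o cats0 size_labels -factor_path_point => -[x [Yx xq /factorP xe]].
exists x => // i iM; have [iN|Ni] := lerP i (- N%:Z).
  by rewrite xq // path_point_past.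
have := xe `|(i - 1 + N%:Z)%R|%N.
rewrite (_ : 1 - N%:Z + _ = i); [apply; lia|lia].
Qed.

Lemma edge_label_eq e f n :
  (forall k, (k <= n)%N -> label e k = label f k) -> val e n = val f n.
Proof.
move=> ef; have ls k : (k <= n.+1)%N -> labels e k = labels f k.
  move=> kn; apply/eq_in_map => i; rewrite mem_iota => /andP[_ ik].
  by apply: ef; lia.
by apply: edge_at_eq; rewrite ?(source_labels _ _).2 ?ls ?ef.
Qed.

Lemma path_point_inj : injective path_point.
Proof.
move=> e f ef; apply/val_inj/functional_extensionality_dep => n.
by apply: edge_label_eq => k _; rewrite -!path_point_label ef.
Qed.

Lemma vertex_ex n w : size w = n -> F [::] w ->
  exists v : follower_vertex F n, val v = follower_class F n w.
Proof.
move=> /eqP sw Fw; pose P := fun C : {set n.-tuple A} =>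
  `[< exists2 u : n.-tuple A, F [::] u & C = follower_class F n u >].
have vP : P (follower_class F n w) by apply/asboolP; exists (Tuple sw).
by exists (exist P _ vP).
Qed.

Lemma edge_ex n w a (v : follower_vertex F n) (v' : follower_vertex F n.+1) :
  size w = n -> F [::] w -> val v = follower_class F n w -> F w [:: a] ->
  val v' = follower_class F n.+1 (ext w a) ->
  exists e : follower_edge F ext n, val e = (v, a, v').
Proof.
move=> /eqP sw Fw vw Fa v'w.
pose P := fun e : follower_vertex F n * A * follower_vertex F n.+1 =>
  `[< exists u : n.-tuple A, [/\ F [::] u, val e.1.1 = follower_class F n u,
    F u [:: e.1.2] & val e.2 = follower_class F n.+1 (ext u e.1.2)] >].
have eP : P (v, a, v') by apply/asboolP; exists (Tuple sw).
by exists (exist P _ eP).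
Qed.

(** The path visits the classes of the words that [x] spells from position [1 - N] on. *)
Lemma path_point_surj x : Y x -> (forall n : int, n <= - N%:Z -> x n = q n) ->
  exists e, path_point e = x.
Proof.
move=> Yx xq; pose w n := factor x (1 - N%:Z) n.
have Fw n : F [::] (o (w n)).
  by apply/F_nil/F_o; exists x; rewrite cats0 size_factor.
have sw n : size (o (w n)) = n by rewrite size_o size_factor.
pose vx n := projT1 (cid (vertex_ex (sw n) (Fw n))).
have vxE n : val (vx n) = follower_class F n (o (w n)).
  exact: projT2 (cid (vertex_ex (sw n) (Fw n))).
have Fa n : F (o (w n)) [:: x (1 - N%:Z + n%:Z)].
  by apply/F_prefix; rewrite -factorS.
have vxS n : val (vx n.+1) =
    follower_class F n.+1 (ext (o (w n)) (x (1 - N%:Z + n%:Z))).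
  by rewrite vxE ext_o -factorS.
pose ex n := projT1 (cid (edge_ex (sw n) (Fw n) (vxE n) (Fa n) (vxS n))).
have exE n : val (ex n) = (vx n, x (1 - N%:Z + n%:Z), vx n.+1).
  exact: projT2 (cid (edge_ex (sw n) (Fw n) (vxE n) (Fa n) (vxS n))).
have pP : `[< forall n, @term B n (ex n) = @init B n.+1 (ex n.+1) >].
  by apply/asboolP => n /=; rewrite !exE.
pose e : bpath B := exist (fun e : forall n, edge B n =>
  `[< forall n, term (e n) = init (e n.+1) >]) ex pP.
exists e.
apply/funext => i; have [iN|Ni] := lerP i (- N%:Z).
  by rewrite path_point_past ?xq.
have -> : i = 1 - N%:Z + `|(i - 1 + N%:Z)%R|%N%:Z by lia.
by rewrite path_point_label /label /= exE.
Qed.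

(** To the right of [-N], the splice spells the first [m] labels of [f] followed by a word of [z].
    That word continues the labels of [e], hence also those of [f], so [F_o] completes every
    window. *)
Lemma F_splice e f m z : F (o (labels e m)) = F (o (labels f m)) ->
  (forall n : int, n <= m%:Z - N%:Z -> z n = path_point e n) -> Y z ->
  Y (splice (path_point f) z (m%:Z - N%:Z)).
Proof.
move=> Fef ze Yz; apply: Y_closed => K; set s := splice _ _ _.
pose v := factor z (1 - N%:Z + m%:Z) (K + N).
have : F (o (labels e m)) (o v).
  apply/F_o; exists z; split=> //.
    by move=> n nN; rewrite ze ?path_point_past //; lia.
  rewrite size_cat size_labels size_factor factorD; congr (_ ++ _).
  by rewrite -factor_path_point; apply/factorP => k km; rewrite ze //; lia.
rewrite Fef F_o size_cat size_labels size_factor => -[x [Yx xq]].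
have -> : labels f m ++ v = factor s (1 - N%:Z) (m + (K + N)).
  rewrite factorD -factor_path_point.
  congr (_ ++ _); apply/factorP => k km; rewrite /s /splice.
    by rewrite ifT //; lia.
  by rewrite ifF //; lia.
move=> /factorP xs; exists x => // i iK; have [iN|Ni] := lerP i (- N%:Z).
  by rewrite xq // /s /splice ifT ?path_point_past //; lia.
have := xs `|(i - 1 + N%:Z)%R|%N.
rewrite (_ : 1 - N%:Z + _ = i); [apply; lia|lia].
Qed.

(** Paths with the same edge at level [m] leave the same vertex there, so their follower sets agree
    and [F_splice] applies. Conversely twins have equal follower sets at level [m], and from then on
    equal labels. *)
Lemma tail_twin e f m : (forall n, (m <= n)%N -> val e n = val f n) <->
  twin Y (m%:Z - N%:Z) (path_point e) (path_point f).
Proof.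
split=> [ef|ef].
  have Fef : F (o (labels e m)) = F (o (labels f m)).
    have [F1 s1] := source_labels e m; have [F2 s2] := source_labels f m.
    apply: (@follower_class_inj m) => //; first by rewrite size_o size_labels.
    by rewrite -s1 -s2 /source /edge_at ef.
  split=> [n mn|z ze].
    have -> : n = 1 - N%:Z + `|(n - 1 + N%:Z)%R|%N%:Z by lia.
    by rewrite !path_point_label /label ef //; lia.
  split=> [|Ys]; first exact: F_splice Fef ze.
  (* Splicing the ray of [e] back onto the spliced point returns [z], so the converse is the same
     argument with [e] and [f] exchanged. *)
  rewrite -(splice_id ze) -(splice_splice _ (path_point f)).
  by apply: (F_splice (esym Fef) _ Ys) => n nm; rewrite /splice nm.
(* A point completing the labels of [f1] by [v] becomes, after its left ray is replaced by that of
   [f2], a completion of the labels of [f2] by the same [v]. *)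
have half f1 f2 v : twin Y (m%:Z - N%:Z) (path_point f1) (path_point f2) ->
    F (o (labels f1 m)) (o v) -> F (o (labels f2 m)) (o v).
  move=> tw; rewrite !F_o !size_cat !size_labels => -[x [Yx xq]].
  rewrite factorD => /eqP; rewrite eqseq_cat ?size_factor ?size_labels //.
  move=> /andP[/eqP + /eqP xv]; rewrite -factor_path_point => /factorP xf.
  exists (splice (path_point f2) x (m%:Z - N%:Z)); split.
  - apply/(tw.2 x) => // n nm; have [nN|Nn] := lerP n (- N%:Z).
      by rewrite xq ?path_point_past.
    have := xf `|(n - 1 + N%:Z)%R|%N.
    rewrite (_ : 1 - N%:Z + _ = n); [apply; lia|lia].
  - by move=> n nN; rewrite /splice ifT ?path_point_past //; lia.
  - rewrite factorD -factor_path_point; congr (_ ++ _).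
      by apply/factorP => k km; rewrite /splice ifT //; lia.
    by rewrite -[RHS]xv; apply/factorP => k km; rewrite /splice ifF //; lia.
have le k : (m <= k)%N -> label e k = label f k.
  by move=> mk; rewrite -!path_point_label; apply: ef.1; lia.
(* Twinning gives the equality at level [m]; common labels and [F_rcons] propagate it upwards. *)
have Fef k : (m <= k)%N -> F (o (labels e k)) = F (o (labels f k)).
  elim: k => [|k IH]; last rewrite leq_eqVlt => /predU1P[<-|mk].
  - rewrite leqn0 => /eqP m0; rewrite -m0; apply/funext => v; rewrite -(oK v).
    by apply/propext; split; apply: half => //; exact: twin_sym.
  - apply/funext => v; rewrite -(oK v).
    by apply/propext; split; apply: half => //; exact: twin_sym.
  - by rewrite !labelsS le //; apply: F_rcons; exact: IH.
move=> n mn; apply: edge_at_eq; last 1 first.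
- by rewrite !(source_labels _ _).2; apply: follower_class_eq; apply: Fef; lia.
- by rewrite !(source_labels _ _).2; apply: follower_class_eq; exact: Fef.
- exact: le.
Qed.

Definition path_pair (g : tail_arrow B) : T * T :=
  (path_point (val g).1, path_point (val g).2).

Lemma path_pair_inj : injective path_pair.
Proof.
move=> g h [/path_point_inj e1 /path_point_inj e2]; apply/val_inj.
by rewrite [LHS]surjective_pairing e1 e2 -surjective_pairing.
Qed.

Lemma path_pair_arrow g : arrow_pair Y q (path_pair g).
Proof.
have /asboolP[m /tail_twin gm] := valP g.
split; try exact: path_point_in.
- by exists (- N%:Z) => n; exact: path_point_past.
- by exists (- N%:Z) => n; exact: path_point_past.
- by exists m; apply: twin_le gm _; lia.
Qed.

Lemma path_pair_surj u : (forall n : int, n <= - N%:Z -> u.1 n = q n) ->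
  (forall n : int, n <= - N%:Z -> u.2 n = q n) -> arrow_pair Y q u ->
  exists g, path_pair g = u.
Proof.
move=> q1 q2 [_ _ Y1 Y2 [m tw]].
have [e eu] := path_point_surj Y1 q1; have [f fu] := path_point_surj Y2 q2.
have efP : `[< exists m, forall n, (m <= n)%N ->
    val (e, f).1 n = val (e, f).2 n >].
  apply/asboolP; exists (m + N)%N; apply/tail_twin.
  by rewrite /= eu fu PoszD addrK.
exists (exist (fun g : bpath B * bpath B => `[< exists m, forall n,
  (m <= n)%N -> val g.1 n = val g.2 n >]) (e, f) efP).
by rewrite /path_pair /= eu fu -surjective_pairing.
Qed.

Lemma path_pair_prod g h k :
  tail_prod g h k <-> pair_prod (path_pair g) (path_pair h) (path_pair k).
Proof.
rewrite /tail_prod /pair_prod /path_pair /=; split=> [[-> ->] //|].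
move=> [/path_point_inj -> [/path_point_inj <- /path_point_inj <-]].
by rewrite -surjective_pairing.
Qed.

(** Level [m + N] corresponds to position [m]: the labels below that level fill the positions from
    [1 - N] to [m]. *)
Lemma tail_cylinder_graph g h (m : nat) :
  tail_cylinder (val g).1 (val g).2 (m + N) h ->
  splice_graph (path_pair g) m (path_pair h).
Proof.
move=> [hg hm]; split=> [n nm|]; rewrite /path_pair /=.
  have [nN|Nn] := lerP n (- N%:Z); first by rewrite !path_point_past.
  rewrite (_ : n = 1 - N%:Z + `|(n - 1 + N%:Z)%R|%N%:Z); last by lia.
  by rewrite !path_point_label /label (hg _ _).1 //; lia.
apply/funext => n; rewrite /splice; have [nN|Nn] := lerP n (- N%:Z).
  by rewrite ifT ?path_point_past //; lia.
rewrite {1 3 4}(_ : n = 1 - N%:Z + `|(n - 1 + N%:Z)%R|%N%:Z); last by lia.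
rewrite !path_point_label /label; case: ifPn => nm.
  by rewrite (hg _ _).2 //; lia.
by rewrite hm //; lia.
Qed.

(** Beyond level [m + N] equal labels would not suffice, since edges also record vertices. By
    [twin_graph] the points of [h] are twins at [m], and [tail_twin] turns this into equality of
    edges. *)
Lemma graph_tail_cylinder g h (m : nat) :
  twin Y m%:Z (path_pair g).1 (path_pair g).2 ->
  splice_graph (path_pair g) m (path_pair h) ->
  tail_cylinder (val g).1 (val g).2 (m + N) h.
Proof.
rewrite /path_pair => tw [/= h1 h2]; split=> n nm; last first.
  apply/esym; move: n nm; apply/tail_twin; rewrite PoszD addrK.
  by rewrite h2; exact: twin_graph tw h1.
split; apply: edge_label_eq => k kn; rewrite -!path_point_label.
  by apply: h1; lia.
by rewrite h2 /splice ifT //; lia.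
Qed.

End Paths.

(** * Local conjugacies *)

Section Conjugacies.
Context (R : realType) {A : finType}.
Notation T := (fullshift A).
(* [c] is the identity for lcs and the reflection n |-> -n for lcu, and [Y] is
   the image of the shift space under [c]. *)
Variables (Y : set T) (c : T -> T) (S : T -> nat -> set T) (phi : T -> T).
Hypothesis cK : involutive c.
Hypothesis c_local : forall (x y : T) (M : nat),
  (forall i : int, `|i| < M%:Z -> x i = y i) ->
  forall i : int, `|i| < M%:Z -> c x i = c y i.
Hypothesis c_phi : forall n x i, c (iter n phi x) i = c x (i + n%:Z).
Hypothesis S_E : forall x N y,
  S x N y <-> Y (c y) /\ forall n : int, n <= N%:Z -> c y n = c x n.
Implicit Types (x y z t : T).

Lemma continuous_within_local (D : set T) (f : T -> T) z M :
  {within D, continuous f} -> D z ->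
  exists K : nat, forall t, D t ->
    (forall i : int, `|i| < K%:Z -> c t i = c z i) ->
    forall i : int, `|i| < M%:Z -> c (f t) i = c (f z) i.
Proof.
move=> /subspace_continuousP cf Dz.
have /cylinder_base[K HK] := cf z Dz _ (nbhs_cylinder (f z) M).
exists K => t Dt tz; apply: c_local; apply: HK => // i iK.
by rewrite -(cK t) -(cK z); apply: c_local iK.
Qed.

Lemma conjugacy_twin x N y N' gamma z :
  local_conjugacy R S phi x N y N' gamma -> S x N z ->
  exists m0, forall m, (m0 <= m)%N -> [/\ (N <= m)%N,
    twin Y m%:Z (c z) (c (gamma z))
    & forall t, S z m t -> c (gamma t) = splice (c (gamma z)) (c t) m%:Z].
Proof.
move=> lg Sz; have [M HM] := local_conjugacy_tail lg.
have tail (n : int) t : M%:Z <= n -> S x N t -> c t n = c (gamma t) n.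
  move=> Mn St; rewrite -[n]gez0_abs; last by lia.
  rewrite -[`|n|%N%:Z]add0r -!c_phi.
  apply: (@c_local _ _ 1%N) => // i i1; have -> : i = 0 by lia.
  by apply: HM => //; lia.
case: lg => -[delta [V [oV imE dK cg cd]] gx _].
have img t : S x N t -> S y N' (gamma t) /\ V (gamma t).
  move=> St; have : (gamma @` S x N) (gamma t) by exists t.
  by rewrite imE => -[].
have [K1 near1] := continuous_within_local M cg Sz.
have [K2 near2] := continuous_within_local M cd
  (ex_intro2 _ _ z Sz erefl : (gamma @` S x N) (gamma z)).
have /cylinder_base[K3 HV] : nbhs (gamma z) V.
  by apply: open_nbhs_nbhs; split=> //; exact: (img _ Sz).2.
have [[Szz zx] [/S_E[_ gzy] _]] := (iffLR (S_E _ _ _) Sz, img _ Sz).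
(* The bound collects the sizes [N] and [N'] of the local sets, the place [M] beyond which [gamma]
   fixes coordinates, the radii [K1] and [K2] from continuity of [gamma] and of its inverse, and the
   radius [K3] of a cylinder inside [V]. *)
pose m0 := (maxn (maxn N N') (maxn M (maxn K1 (maxn K2 K3)))).
exists m0 => m; rewrite /m0 !geq_max => /and3P[/andP[Nm N'm] Mm /and3P[K1m K2m K3m]].
have graph t : S z m t -> c (gamma t) = splice (c (gamma z)) (c t) m%:Z.
  move=> /S_E[Yt tz]; have St : S x N t.
    by apply/S_E; split=> // n nN; rewrite tz ?zx //; lia.
  have [/S_E[_ gty] _] := img _ St.
  apply/funext => n; rewrite /splice; case: ifPn => nm; last first.
    by rewrite -tail //; lia.
  (* Negative coordinates are those of [y], coordinates in [[0, M)] are fixed by continuity, and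
     later ones by uniform convergence. *)
  have [n0|n0] := ltrP n 0; first by rewrite gty ?gzy //; lia.
  have [nM|Mn] := ltrP n M%:Z; last by rewrite -!tail // tz.
  by apply: near1 => //; [move=> i iK; apply: tz; lia | lia].
split=> //; split=> [n mn|z' z'z]; first by rewrite tail //; lia.
split=> [Yz'|Ys].
  have St : S z m (c z') by apply/S_E; rewrite cK.
  have := graph _ St; rewrite cK => <-.
  have Sx : S x N (c z').
    by apply/S_E; rewrite cK; split=> // n nN; rewrite z'z ?zx //; lia.
  by have [/S_E[]] := img _ Sx.
(* Openness of the image is used here: the spliced point has the past of [y] and lies in [V], so it
   comes from some [r]. Continuity of the inverse then identifies [r] with [z'] on [[0, M)]. *)
set s := splice _ _ _ in Ys.
have [r Sr rs] : (gamma @` S x N) (c s).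
  rewrite imE; split.
    apply/S_E; rewrite cK; split=> // n nN'.
    by rewrite /s /splice ifT ?gzy //; lia.
  apply: HV => i iK; rewrite -[gamma z]cK.
  by apply: c_local iK => j jK; rewrite /s /splice ifT //; lia.
suff <- : c r = z' by have /S_E[] := Sr.
have cs : c (gamma r) = s by rewrite rs cK.
have /S_E[_ rx] := Sr.
apply/funext => n; have [nm|mn] := lerP n m%:Z; last first.
  by rewrite tail ?cs /s /splice ?ifF //; lia.
have [n0|n0] := ltrP n 0; first by rewrite rx ?z'z ?zx //; lia.
have [nM|Mn] := ltrP n M%:Z; last first.
  by rewrite tail // cs /s /splice nm -tail // z'z.
rewrite z'z // -(dK _ Sr) -[in RHS](dK _ Sz); apply: near2.
- by exists r.
- by move=> i iK; rewrite cs /s /splice ifT //; lia.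
- lia.
Qed.

Lemma splice_continuous y m : continuous (fun t => c (splice (c y) (c t) m)).
Proof.
move=> z U /cylinder_base[M HM].
apply: filterS (nbhs_cylinder z M) => t tz; apply: HM; apply: c_local => i iM.
by rewrite /splice; case: ifP => // _; apply: c_local iM.
Qed.

(** Splicing with the ray of [x] undoes splicing with that of [y], and twinning keeps both maps
    inside [Y]. The image is the full local set of [y], so the open set can be everything. *)
Lemma twin_conjugacy x y (m : nat) :
  Y (c x) -> twin Y m%:Z (c x) (c y) ->
  local_conjugacy R S phi x m y m (fun t => c (splice (c y) (c t) m%:Z)).
Proof.
move=> Yx xy; have yx := twin_sym xy.
have spl u v t : twin Y m%:Z (c u) (c v) -> S u m t ->
    S v m (c (splice (c v) (c t) m%:Z)).
  move=> uv /S_E[Yt tu]; apply/S_E; rewrite cK; split.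
    by apply/(uv.2 (c t)).
  by move=> n nm; rewrite /splice nm.
have inv u v t : S u m t ->
    c (splice (c u) (c (c (splice (c v) (c t) m%:Z))) m%:Z) = t.
  by move=> /S_E[_ tu]; rewrite cK splice_splice splice_id ?cK.
split.
- exists (fun t => c (splice (c x) (c t) m%:Z)), setT; split.
  + exact: openT.
  + rewrite setIT; apply/seteqP; split=> [_ [t St <-]|t St]; first exact: spl xy _.
    by exists (c (splice (c x) (c t) m%:Z)); [exact: spl yx _ | exact: inv].
  + by move=> t St; exact: inv.
  + by apply: continuous_subspaceT; exact: splice_continuous.
  + by apply: continuous_subspaceT; exact: splice_continuous.
- by rewrite (splice_twin xy) cK.
set D := fun n => _.
(* The two points agree beyond [m], so after [n] shifts they agree on radius [n - m]. The condition
   [m < n] makes this radius at least 1, as [shift_dist] demands. *)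
have D0 n : (m < n)%N -> 0 <= D n <= 2^-1 ^+ (n - m).
  move=> mn; have Sx : S x m x by apply/S_E.
  apply/andP; split.
    apply: le_trans (shift_dist_ge0 R (iter n phi x)
      (iter n phi (c (splice (c y) (c x) m%:Z)))) _.
    by apply: ub_le_sup; [exact: dist_ubound | exists x].
  apply: ge_sup; first by eexists; exists x.
  move=> _ [z Sz <-]; set z' := c _.
  have zz' i : `|i| < (n - m)%N%:Z -> iter n phi z i = iter n phi z' i.
    rewrite -[iter n phi z]cK -[iter n phi z']cK; apply: c_local => j jM.
    by rewrite !c_phi /z' cK /splice ifF //; lia.
  rewrite /shift_dist zz' ?eqxx; last by lia.
  apply: ge_inf; first by exists 0; exact: shift_dist_set_lb.
  by exists (n - m)%N => //; split=> //; lia.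
apply: (squeeze_cvgr _ (cvg_cst _)); last first.
  have : (fun n => 2^-1 ^+ n : R) @ \oo --> (0 : R).
    by apply: cvg_expr; rewrite ger0_norm ?invf_lt1 ?ltr1n.
  by rewrite -(cvg_centern m); exact.
by exists m.+1 => // n /= mn; exact: D0.
Qed.

Section Arrows.
Variables (P : set T) (q : T).
Hypothesis P_E : forall x,
  P x <-> Y (c x) /\ exists M : int, forall n, n <= M -> c x n = q n.

Definition lc_pair (g : lc_arrow R S phi P) : T * T :=
  (c (val g).1, c (val g).2).

Lemma lc_pair_inj : injective lc_pair.
Proof.
move=> g h [/(can_inj cK) e1 /(can_inj cK) e2]; apply/val_inj.
by rewrite [LHS]surjective_pairing e1 e2 -surjective_pairing.
Qed.

Lemma lc_pair_prod g h k :
  lc_prod g h k <-> pair_prod (lc_pair g) (lc_pair h) (lc_pair k).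
Proof.
rewrite /lc_prod /pair_prod /lc_pair /=; split=> [[-> ->] //|].
move=> [/(can_inj cK) -> [/(can_inj cK) e1 /(can_inj cK) e2]].
by split=> //; rewrite [LHS]surjective_pairing e1 e2.
Qed.

Lemma lc_pairP u : arrow_pair Y q u <-> exists g, lc_pair g = u.
Proof.
split=> [[u1 u2 Y1 Y2 [m tw]]|[g <-]].
  have gP : `[< [/\ P (c u.1), P (c u.2)
      & locally_conjugate R S phi (c u.1) (c u.2)] >].
    apply/asboolP; split; rewrite ?P_E ?cK //.
    exists m, m, (fun t => c (splice (c (c u.2)) (c t) m%:Z)).
    by apply: twin_conjugacy; rewrite !cK.
  exists (exist (fun g : T * T => `[< [/\ P g.1, P g.2
      & locally_conjugate R S phi g.1 g.2] >]) (c u.1, c u.2) gP).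
  by rewrite /lc_pair /= !cK; case: u {u1 u2 Y1 Y2 tw gP}.
have /asboolP[/P_E[Y1 q1] /P_E[Y2 q2] [N [N' [gamma lg]]]] := valP g.
have gx : gamma (val g).1 = (val g).2 by have [] := lg.
have Sx : S (val g).1 N (val g).1 by apply/S_E.
have [m0 /(_ m0 (leqnn _))[_ tw _]] := conjugacy_twin lg Sx.
by split=> //; exists m0; rewrite gx in tw.
Qed.

Lemma lc_basis_graph U g : @lc_basis R A S phi P U -> U g ->
  exists2 m : nat, twin Y m%:Z (lc_pair g).1 (lc_pair g).2 &
    forall h, splice_graph (lc_pair g) m (lc_pair h) -> U h.
Proof.
move=> [x [N [N' [gamma [Px Pgx lg ->]]]]] [/= Sg Eg].
have [m0 /(_ m0 (leqnn _))[Nm0 tw H]] := conjugacy_twin lg Sg.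
exists m0; first by rewrite /= Eg.
move=> h [/= h1 h2]; have /asboolP[/P_E[Yh _] _ _] := valP h.
have Sh : S (val g).1 m0 (val h).1 by apply/S_E.
split; last by apply: (can_inj cK); rewrite H // -Eg.
have /S_E[_ gx] := Sg.
by apply/S_E; split=> // n nN; rewrite h1 ?gx //; lia.
Qed.

Lemma graph_lc_basis g (m : nat) : twin Y m%:Z (lc_pair g).1 (lc_pair g).2 ->
  @lc_basis R A S phi P
    [set h | splice_graph (lc_pair g) m (lc_pair h)].
Proof.
move=> tw; have /asboolP[P1 P2 _] := valP g.
have g2 : c (splice (c (val g).2) (c (val g).1) m%:Z) = (val g).2.
  by rewrite (splice_twin tw) cK.
exists (val g).1, m, m, (fun t => c (splice (c (val g).2) (c t) m%:Z)).
rewrite g2; split=> //; first by apply: twin_conjugacy => //; have /P_E[] := P1.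
apply/seteqP; split=> h [].
  move=> h1 h2; have /asboolP[/P_E[Yh _] _ _] := valP h.
  by split; [apply/S_E | rewrite -[LHS]cK; exact: (congr1 c h2)].
by move=> /S_E[_ h1] h2; split=> //; rewrite /lc_pair /= h2 cK.
Qed.

Lemma lc_basis_nbhs g U :
  (exists W, [/\ @lc_basis R A S phi P W, W g & W `<=` U]) <->
  exists2 m : nat, twin Y m%:Z (lc_pair g).1 (lc_pair g).2 &
    forall h, splice_graph (lc_pair g) m (lc_pair h) -> U h.
Proof.
split=> [[W [/lc_basis_graph bW /bW[m tw WP] WU]]|[m tw gU]].
  by exists m => // h /WP /WU.
exists [set h | splice_graph (lc_pair g) m (lc_pair h)]; split=> //.
  exact: graph_lc_basis.
by split=> //; rewrite (splice_twin tw).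
Qed.

End Arrows.
End Conjugacies.

(** * The union of the path groupoids *)

Lemma nbhs_tail_cylinder (B : bratteli) (g : tail_arrow B) m :
  (forall n, (m <= n)%N -> val (val g).1 n = val (val g).2 n) ->
  nbhs g (tail_cylinder (val g).1 (val g).2 m).
Proof.
move=> gm; apply: open_nbhs_nbhs; split; last by split=> // n /gm.
by exists [set tail_cylinder (val g).1 (val g).2 m];
  [move=> _ ->; exists (val g).1, (val g).2, m | rewrite bigcup_set1].
Qed.

Lemma nbhs_tailP (B : bratteli) (g : tail_arrow B) U : nbhs g U ->
  exists m0, forall m, (m0 <= m)%N ->
    tail_cylinder (val g).1 (val g).2 m `<=` U.
Proof.
rewrite nbhsE => -[V [[D Dbase <-] [W DW Wg]] VU].
have [e [e' [m0 [ee' We]]]] := Dbase _ DW; exists m0 => m m0m h hm; apply: VU.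
exists W => //; rewrite {}We in Wg *.
case: Wg hm => ge gt [h1 h2]; split=> n nm.
  by have [-> ->] := h1 n (leq_trans nm m0m); exact: ge.
have [nm'|mn] := ltnP n m; last exact: h2.
by have [-> ->] := h1 n nm'; exact: gt.
Qed.

Section Union.
Local Open Scope quotient_scope.
Variable G : groupoid_sequence.

Lemma union_repr (u : union_space G) : exists N (g : stage G N), u = to_union g.
Proof.
have -> : u = \pi_({eq_quot union_equiv G}) (repr u) by rewrite reprK.
by case: (repr u) => N g; exists N, g.
Qed.

Lemma to_union_incl N (g : stage G N) (h : stage G N.+1) :
  incl g h -> to_union g = to_union h.
Proof.
by move=> gh; apply/eqmodP/asboolP; apply: rst_step; exact: InclStep.
Qed.

(** The union is a quotient by a generated equivalence, so compatibility with single inclusions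
    suffices. Applied to the pair of points of an arrow, it shows that arrows with different pairs
    stay distinct. *)
Lemma union_invariant (V : Type) (f : forall N, stage G N -> V) :
  (forall N (g : stage G N) (h : stage G N.+1), incl g h -> f N g = f N.+1 h) ->
  forall N (g : stage G N) N' (h : stage G N'), to_union g = to_union h ->
    f N g = f N' h.
Proof.
move=> fi N g N' h /eqmodP/asboolP.
pose fs (u : {N & stage G N}) := f (projT1 u) (projT2 u).
suff inv u v : clos_refl_sym_trans _ (@incl_step G) u v -> fs u = fs v.
  exact: inv.
by elim=> {u v}[_ _ [M a b ab]|||u v w _ -> _ ->] //; exact: fi.
Qed.

Lemma to_union_continuous N : continuous (@to_union G N).
Proof.
move=> g U nU; have := @pi_continuous _ {eq_quot union_equiv G} (existT _ N g) U nU.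
exact: existT_continuous.
Qed.

Lemma union_continuous (V : topologicalType) (f : union_space G -> V) :
  (forall N, continuous (fun g : stage G N => f (to_union g))) -> continuous f.
Proof.
move=> fc; apply/quotient_continuous => -[N g] U nU; exact: (fc N g U nU).
Qed.

End Union.

(** * Comparison through pairs of points *)

Section UnionOfPaths.
Context {A : finType}.
Notation T := (fullshift A).
Variables (Y : set T) (q : T) (a : nat -> A).
Variables (F : nat -> seq A -> set (seq A)) (ext : seq A -> A -> seq A).
Variable o : seq A -> seq A.
Hypotheses (oK : involutive o) (size_o : forall w, size (o w) = size w).
Hypotheses (o_seq1 : forall b, o [:: b] = [:: b]).
Hypothesis ext_o : forall w b, ext (o w) b = o (rcons w b).
Hypothesis Y_closed : cylinder_closed Y.
Hypothesis a_q : forall N, a N = q (- N%:Z).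
Hypothesis F_o : forall N w v, F N (o w) (o v) <->
  exists x, [/\ Y x, forall n : int, n <= - N%:Z -> x n = q n
    & factor x (1 - N%:Z) (size (w ++ v)) = w ++ v].

(* [G] is Glcs or Glcu, and [j] the embedding [lc_pair]. *)
Variables (G : topGroupoid) (j : G -> T * T).
Hypothesis j_inj : injective j.
Hypothesis jP : forall u, arrow_pair Y q u <-> exists g, j g = u.
Hypothesis j_nbhs : forall g U, nbhs g U <->
  exists2 m : nat, twin Y m%:Z (j g).1 (j g).2 &
    forall h, splice_graph (j g) m (j h) -> U h.
Hypothesis j_prod : forall g h k,
  gprod g h k <-> pair_prod (j g) (j h) (j k).

Let B N := follower_diagram (F N) ext.
Let sequence := @GroupoidSequence (fun N => bratteli_groupoid (B N))
  (fun N => prefix_arrow (a N)).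
Let pair N (g : tail_arrow (B N)) := path_pair q N g.

(** The new label [q (-N)] is put at position [-N], where the point already has it: only the
    starting position of the reading moves. *)
Lemma prefix_path_point N (e : bpath (B N)) (f : bpath (B N.+1)) :
  prefix_path (a N) e f <-> path_point q N e = path_point q N.+1 f.
Proof.
split=> [[f0 fS]|ef].
  apply/funext => n; have [nN|Nn] := lerP n (- N%:Z); last first.
    rewrite [n in LHS](_ : _ = 1 - N%:Z + `|(n - 1 + N%:Z)%R|%N%:Z); last by lia.
    rewrite [n in RHS](_ : _ = 1 - N.+1%:Z + `|(n - 1 + N%:Z)%R|%N.+1%:Z).
      by rewrite !path_point_label fS.
    by lia.
  rewrite path_point_past //; have [nN1|] := lerP n (- N.+1%:Z).
    by rewrite path_point_past.
  move=> Nn; rewrite (_ : n = - N%:Z); last by lia.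
  rewrite -a_q -f0 -(path_point_label q N.+1); congr (path_point _ _ _ _); lia.
split=> [|n]; rewrite -(path_point_label q N.+1 f) -?(path_point_label q N e).
  by rewrite -ef path_point_past ?a_q; [congr (q _)|]; lia.
by rewrite ef; congr (path_point _ _ _ _); lia.
Qed.

Lemma prefix_arrow_pair N (g : tail_arrow (B N)) (h : tail_arrow (B N.+1)) :
  prefix_arrow (a N) g h <-> pair g = pair h.
Proof.
rewrite /prefix_arrow !prefix_path_point /pair /path_pair.
by split=> [[-> ->] //|[-> ->]].
Qed.

Lemma pair_stage u : arrow_pair Y q u ->
  exists N0, forall N, (N0 <= N)%N -> exists g : tail_arrow (B N), pair g = u.
Proof.
move=> uY; have [[M1 u1] [M2 u2] _ _ _] := uY.
exists (`|M1|%N + `|M2|%N)%N => N HN.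
apply: (path_pair_surj oK size_o o_seq1 ext_o Y_closed (@F_o N)) => //.
  by move=> n nN; apply: u1; lia.
by move=> n nN; apply: u2; lia.
Qed.

(** Inclusions are given as graphs, so the image of an arrow in a later stage has to be produced,
    here by [path_pair_surj]. With index [d + N] the inductive step reduces to a successor stage by
    computation. *)
Lemma pair_lift N (g : tail_arrow (B N)) d : exists h : tail_arrow (B (d + N)),
  @to_union sequence _ g = @to_union sequence _ h /\ pair g = pair h.
Proof.
elim: d => [|d [h [gh1 gh2]]]; first by exists g.
have hq i : forall n : int, n <= - (d.+1 + N)%N%:Z ->
    (if i : bool then (pair h).1 else (pair h).2) n = q n.
  by move=> n nN; case: i; rewrite /= path_point_past //; lia.
have [h' hh'] := path_pair_surj oK size_o o_seq1 ext_o Y_closed (@F_o (d.+1 + N))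
  (hq true) (hq false) (path_pair_arrow oK size_o o_seq1 ext_o Y_closed (@F_o _) h).
exists h'; split; last by rewrite gh2 -hh'.
by rewrite gh1; apply: to_union_incl; apply/prefix_arrow_pair.
Qed.

Lemma to_union_pair N (g : tail_arrow (B N)) N' (h : tail_arrow (B N')) :
  @to_union sequence _ g = @to_union sequence _ h <-> pair g = pair h.
Proof.
split=> [|gh].
  apply: (@union_invariant sequence _ pair) => M b b'.
  by move/prefix_arrow_pair.
(* Both arrows are lifted to a common stage, where the pair determines the arrow; the two forms of
   its index still have to be matched. *)
have [g' [-> gg']] := pair_lift g N'; have [h' [-> hh']] := pair_lift h N.
have NN : (N + N' = N' + N)%N by rewrite addnC.
move: h' hh'; rewrite NN => h' hh'; congr to_union.
by apply: (path_pair_inj oK size_o o_seq1 ext_o (@F_o _)); rewrite -[LHS]gg' gh.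
Qed.

(** The maps [f] and [k], obtained by choice, match arrows having the same pair of points. Since
    pairs determine arrows on both sides, this fixes them and makes them mutually inverse. *)
Lemma union_of_paths_iso : topGroupoid_iso G (union_groupoid sequence).
Proof.
have [f fP] : {f : G -> union_space sequence & forall g,
    exists N (h : tail_arrow (B N)), f g = to_union (h : stage sequence N) /\
      pair h = j g}.
  apply: (@choice _ _ (fun g u => exists N (h : tail_arrow (B N)),
    u = to_union (h : stage sequence N) /\ pair h = j g)) => g.
  have [N0 /(_ N0 (leqnn _))[h hg]] :=
    pair_stage (iffRL (jP _) (ex_intro _ g erefl)).
  by exists (to_union (h : stage sequence N0)), N0, h.
have [k kP] : {k : union_space sequence -> G & forall u,
    exists N (h : tail_arrow (B N)), u = to_union (h : stage sequence N) /\
      pair h = j (k u)}.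
  apply: (@choice _ _ (fun u g => exists N (h : tail_arrow (B N)),
    u = to_union (h : stage sequence N) /\ pair h = j g)) => u.
  have [N [h ->]] := union_repr u.
  have [g gh] := iffLR (jP _)
    (path_pair_arrow oK size_o o_seq1 ext_o Y_closed (@F_o _) h).
  by exists g, N, h.
have fE N (h : tail_arrow (B N)) g : pair h = j g ->
    f g = to_union (h : stage sequence N).
  by move=> hg; have [M [h' [-> h'g]]] := fP g; apply/to_union_pair; rewrite h'g.
have kE N (h : tail_arrow (B N)) :
    j (k (to_union (h : stage sequence N))) = pair h.
  by have [M [h' [/to_union_pair -> ->]]] := kP (to_union (h : stage sequence N)).
have fK : cancel f k.
  by move=> g; have [N [h [-> hg]]] := fP g; apply: j_inj; rewrite kE.
have kK : cancel k f.
  by move=> u; have [N [h [uE hu]]] := kP u; rewrite (fE _ _ _ hu).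
exists f, k; split=> //.
- move=> g U; have [N [h [-> hg]]] := fP g => /to_union_continuous/nbhs_tailP.
  move=> [m0 Hm0]; apply/j_nbhs; have /asboolP[m1 hm1] := valP h.
  (* Past [m0] the cylinders lie in the given neighbourhood; past [m1] the two paths of [h]
     coincide, which yields twins. *)
  pose m := maxn m0 m1.
  have tw : twin Y m%:Z (pair h).1 (pair h).2.
    rewrite -(addrK N%:Z m%:Z) -PoszD.
    apply/(tail_twin oK size_o o_seq1 ext_o Y_closed (@F_o _)) => n mn.
    by apply: hm1; rewrite /m in mn; lia.
  exists m; rewrite -hg // => g' gg'.
  have [q1 q2 Y1 Y2 tw'] := iffRL (jP _) (ex_intro _ g' erefl).
  (* An arrow on the splicing graph follows [h] up to position [m], hence has the past of [q] up to
     [-N] and comes from the same stage [N]. *)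
  have past (n : int) : n <= - N%:Z -> (j g').1 n = q n /\ (j g').2 n = q n.
    move=> nN; rewrite gg'.2 /splice ifT; last by lia.
    by rewrite gg'.1 /= ?path_point_past //; lia.
  have [h' h'g'] := path_pair_surj oK size_o o_seq1 ext_o Y_closed (@F_o N)
    (fun n nN => (past n nN).1) (fun n nN => (past n nN).2)
    (And5 q1 q2 Y1 Y2 tw').
  rewrite /= (fE _ _ _ h'g'); apply: (Hm0 (m + N)%N); first by rewrite /m; lia.
  apply: (graph_tail_cylinder oK size_o o_seq1 ext_o Y_closed (@F_o _) tw).
  by rewrite h'g'.
- apply: union_continuous => N h U /j_nbhs[m].
  rewrite kE => tw HU.
  have hm n : (m + N <= n)%N -> val (val h).1 n = val (val h).2 n.
    move: n; apply/(tail_twin oK size_o o_seq1 ext_o Y_closed (@F_o _)).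
    by rewrite PoszD addrK.
  apply: filterS (nbhs_tail_cylinder hm) => h' /(tail_cylinder_graph q) hh'.
  by apply: HU; rewrite kE.
move=> g1 g2 g3; rewrite j_prod; split=> [jp|].
  have st g := pair_stage (iffRL (jP _) (ex_intro _ g erefl)).
  have [[N1 s1] [N2 s2] [N3 s3]] := And3 (st g1) (st g2) (st g3).
  pose N := maxn N1 (maxn N2 N3).
  have [h1 e1] : exists h : tail_arrow (B N), pair h = j g1.
    by apply: s1; rewrite /N; lia.
  have [h2 e2] : exists h : tail_arrow (B N), pair h = j g2.
    by apply: s2; rewrite /N; lia.
  have [h3 e3] : exists h : tail_arrow (B N), pair h = j g3.
    by apply: s3; rewrite /N; lia.
  exists N, h1, h2, h3; split; try exact: fE.
  apply/(path_pair_prod oK size_o o_seq1 ext_o (@F_o N)).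
  by move: jp; rewrite -e1 -e2 -e3.
move=> [N [h1 [h2 [h3 [e1 e2 e3 /=]]]]].
move=> /(path_pair_prod oK size_o o_seq1 ext_o (@F_o N)).
by rewrite -(fK g1) -(fK g2) -(fK g3) e1 e2 e3 !kE.
Qed.

End UnionOfPaths.

(** * Follower and predecessor diagrams *)

Lemma base_nbhsP (V : topologicalType) (base : set (set V)) :
  (forall U : set V, open U <->
    exists2 D, D `<=` base & \bigcup_(W in D) W = U) ->
  forall g U, nbhs g U <-> exists W, [/\ base W, W g & W `<=` U].
Proof.
move=> openP g U; rewrite nbhsE; split=> [[W [/openP[D Dbase <-] [W' DW' W'g]] WU]|].
  by exists W'; split=> //; [exact: Dbase | move=> h W'h; apply: WU; exists W'].
move=> [W [bW Wg WU]]; exists W => //; split=> //; apply/openP.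
by exists [set W]; [move=> _ -> | rewrite bigcup_set1].
Qed.

Section Cuts.
Context {A : finType}.
Variables (X : set (fullshift A)) (p : fullshift A).
Hypotheses (X_shift : shift_space X) (Xp : X p).
Hypotheses (p_sync : synchronizing_point X p) (p_per : periodic_point p).

Lemma periodic_pointP : exists2 d : nat, (0 < d)%N & forall i, p (i + d%:Z) = p i.
Proof.
have [d d0 pd] := p_per; exists d => // i.
by rewrite -iter_shift pd.
Qed.

(** Periodicity supplies an admissible cut, so [xget] does not return its default value. *)
Lemma lcs_cutP N : (N <= lcs_cut X p N)%N /\ synchronizing_word X
  (factor p (- (lcs_cut X p N)%:Z) (lcs_cut X p N - N).+1).
Proof.
apply: (@xgetPex _ N [set k | (N <= k)%N /\
  synchronizing_word X (factor p (- k%:Z) (k - N).+1)]).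
have [d d0 pd] := periodic_pointP.
exact: (periodic_synchronizing (shift_space_invariant X_shift) Xp d0 pd p_sync).
Qed.

Lemma Eplus_pastP N w v : Eplus_past X p N w v <->
  exists x, [/\ X x, forall n : int, n <= - N%:Z -> x n = p n
    & factor x (1 - N%:Z) (size (w ++ v)) = w ++ v].
Proof.
have X_inv := shift_space_invariant X_shift; have [Nk sy] := lcs_cutP N.
rewrite -(language_past X_inv (shift_space_closed X_shift) _ Xp Nk sy).
rewrite /Eplus_past /Eplus /mkset -catA; split=> [[]//|L]; split=> //.
by move: (L); rewrite catA => /(language_catr X_inv).
Qed.

Let Y := [set x | X (flip x)].

Lemma factor_flip_future N k : (N <= k)%N ->
  rev (factor (flip p) (- k%:Z) (k - N).+1) = factor p N%:Z (k - N).+1.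
Proof. by move=> Nk; rewrite factor_flip revK; congr factor; lia. Qed.

Lemma lcu_cutP N : (N <= lcu_cut X p N)%N /\ synchronizing_word X
  (factor p N%:Z (lcu_cut X p N - N).+1).
Proof.
apply: (@xgetPex _ N [set k | (N <= k)%N /\
  synchronizing_word X (factor p N%:Z (k - N).+1)]).
have [d d0 pd] := periodic_pointP.
have Y_inv := flip_invariant (shift_space_invariant X_shift).
have Yp : Y (flip p) by rewrite /Y /= flipK.
have qd i : flip p (i + d%:Z) = flip p i.
  by rewrite /flip -[LHS]pd; congr (p _); lia.
have [k [Nk sy]] := periodic_synchronizing Y_inv Yp d0 qd
  (synchronizing_point_flip p_sync) N.
exists k; split=> //; rewrite -(factor_flip_future Nk).
rewrite (_ : X = [set x | Y (flip x)]).
  by apply: synchronizing_word_flip; rewrite revK.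
by apply/funext => x; rewrite /Y /= flipK.
Qed.

Lemma Eminus_futureP N w v : Eminus_future X p N (rev w) (rev v) <->
  exists x, [/\ Y x, forall n : int, n <= - N%:Z -> x n = flip p n
    & factor x (1 - N%:Z) (size (w ++ v)) = w ++ v].
Proof.
have X_inv := shift_space_invariant X_shift; have [Nk sy] := lcu_cutP N.
rewrite -(factor_flip_future Nk) in sy.
have Yp : Y (flip p) by rewrite /Y /= flipK.
rewrite -(language_past (flip_invariant X_inv)
  (flip_closed (shift_space_closed X_shift)) _ Yp Nk (synchronizing_word_flip sy)).
rewrite language_flip /Eminus_future /Eminus /mkset !rev_cat -catA.
rewrite factor_flip_future //; split=> [[]//|L]; split=> //.
exact: language_catl L.
Qed.

End Cuts.

Theorem theorem4p3 (R : realType) (A : finType) (X : set (fullshift A))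
    (p : fullshift A) (X_shift : shift_space X) (X_sync : synchronizing X)
    (Xp : X p) (p_sync : synchronizing_point X p) (p_per : periodic_point p) :
  topGroupoid_iso (Glcs R X p) (Blcs_union X p) /\
  topGroupoid_iso (Glcu R X p) (Blcu_union X p).
Proof.
have X_closed := shift_space_closed X_shift.
split.
  have idK : @involutive (fullshift A) id by [].
  have c_local (x y : fullshift A) (M : nat) :
    (forall i : int, `|i| < M%:Z -> x i = y i) ->
    forall i : int, `|i| < M%:Z -> x i = y i by [].
  have c_phi n (x : fullshift A) i := iter_shift n x i.
  have S_E x N y : Xu_loc X x N y <->
    X y /\ forall n : int, n <= N%:Z -> y n = x n by [].
  have P_E x : Xu X p x <->
    X x /\ exists M : int, forall n, n <= M -> x n = p n by [].
  apply: (@union_of_paths_iso _ X p (fun N => p (- N%:Z)) (Eplus_past X p)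
    rcons id _ _ _ _ X_closed _ _ (Glcs R X p)
    (@lc_pair R A id (Xu_loc X) shift_map (Xu X p))) => //.
  - exact: Eplus_pastP.
  - exact: lc_pair_inj.
  - exact: (lc_pairP R idK c_local c_phi S_E P_E).
  - move=> g U; rewrite (@base_nbhsP (Glcs R X p)
        (@lc_basis R A (Xu_loc X) shift_map (Xu X p))) //.
    exact: (lc_basis_nbhs idK c_local c_phi S_E P_E).
  - exact: lc_pair_prod.
(* In the unstable case [flip] turns futures into pasts and [rev] accounts for words that grow on
   the left. *)
have flipI : @involutive (fullshift A) flip := @flipK A.
have c_local (x y : fullshift A) (M : nat) :
  (forall i : int, `|i| < M%:Z -> x i = y i) ->
  forall i : int, `|i| < M%:Z -> flip x i = flip y i.
  by move=> xy i iM; apply: xy; lia.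
have c_phi n (x : fullshift A) i :
    flip (iter n unshift_map x) i = flip x (i + n%:Z).
  by rewrite /flip iter_unshift; congr (x _); lia.
have S_E x N y : Xs_loc X x N y <-> X (flip (flip y)) /\
    forall n : int, n <= N%:Z -> flip y n = flip x n.
  rewrite flipK; split=> -[Xy yx]; split=> // n nN; first by apply: yx; lia.
  by rewrite -[n]opprK; apply: yx; lia.
have P_E x : Xs X p x <-> X (flip (flip x)) /\
    exists M : int, forall n, n <= M -> flip x n = flip p n.
  rewrite flipK; split=> -[Xx [M xp]]; split=> //; exists (- M) => n nM.
    by apply: xp; lia.
  by rewrite -[n]opprK; apply: xp; lia.
apply: (@union_of_paths_iso _ [set x | X (flip x)] (flip p) (fun N => p N%:Z)
  (Eminus_future X p) (fun w b => b :: w) rev _ _ _ _ (flip_closed X_closed) _ _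
  (Glcu R X p) (@lc_pair R A flip (Xs_loc X) unshift_map (Xs X p))) => //.
- exact: revK.
- exact: size_rev.
- by move=> w b; rewrite rev_rcons.
- by move=> N; rewrite /flip opprK.
- exact: Eminus_futureP.
- exact: lc_pair_inj.
- exact: (lc_pairP R flipI c_local c_phi S_E P_E).
- move=> g U; rewrite (@base_nbhsP (Glcu R X p)
      (@lc_basis R A (Xs_loc X) unshift_map (Xs X p))) //.
  exact: (lc_basis_nbhs flipI c_local c_phi S_E P_E).
- exact: lc_pair_prod.
Qed.
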